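(* Let $\epsilon>0$, $T>0$ and consider the diffusion $dX^\epsilon(t)=b^\epsilon(X^\epsilon(t))dt+\sqrt\epsilon\,dB(t)$ on $\mathbb R^d$ with time-independent drift $b^\epsilon:\mathbb R^d\to\mathbb R^d$, with arbitrary initial distribution, under the standing assumptions given in the context. Let $\nu^\epsilon$ be the law of $X^\epsilon$ on $C([0,T];\mathbb R^d)$. Then the stochastic total entropy production $\Delta s_{\mathrm{tot}}=s_{\mathrm{tot}}(T,\omega)-s_{\mathrm{tot}}(0,\omega)$ over $[0,T]$ satisfies $$\mathbf E_{\nu^\epsilon}\big[e^{-\Delta s_{\mathrm{tot}}}\big]=\mathbf E_{\nu^\epsilon}\big[e^{-(s_{\mathrm{tot}}(T,\omega)-s_{\mathrm{tot}}(0,\omega))}\big]=1.$$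
   Context: $\rho^\epsilon(t,\cdot)$, $t\in[0,T]$, denotes the probability density of $X^\epsilon(t)$. Current and velocity: $j^\epsilon=b^\epsilon\rho^\epsilon-\frac\epsilon2\nabla\rho^\epsilon$, $v^\epsilon(t,x)=b^\epsilon(x)-\frac\epsilon2\nabla\log\rho^\epsilon(t,x)=j^\epsilon/\rho^\epsilon$. The total entropy production is defined by $$ds_{\mathrm{tot}}(t,\omega)=\frac{(\partial_t\rho^\epsilon)(T-t,\omega(t))}{\rho^\epsilon(T-t,\omega(t))}dt+\frac2\epsilon\frac{j^\epsilon(T-t,\omega(t))}{\rho^\epsilon(T-t,\omega(t))}\circ d\omega(t),$$ and $s_{\mathrm{tot}}(T,\omega)-s_{\mathrm{tot}}(0,\omega)=\int_0^Tds_{\mathrm{tot}}(t,\omega)$. Here $\circ$ is the Stratonovich differential: $\int F(t,\omega(t))\circ d\omega(t)=\int F(t,\omega(t))\cdot d\omega(t)+\frac\epsilon2\int(\nabla\cdot F)(t,\omega(t))dt$. Standing assumptions: $b^\epsilon$ is $C^1$; $\rho^\epsilon$ is strictly positive, $C^{1,2}$ on $[0,T]\times\mathbb R^d$ and satisfies the Fokker--Planck equation $\partial_t\rho^\epsilon=-\nabla\cdot[(b^\epsilon-\frac\epsilon2\nabla\log\rho^\epsilon)\rho^\epsilon]$. Write $\nu^\epsilon_x=\nu^\epsilon(\cdot|\omega(0)=x)$; let $\overleftarrow\nu^\epsilon$ be the image of $\nu^\epsilon$ under time reversal $\omega\mapsto\omega(T-\cdot)$ and $\overleftarrow\nu^\epsilon_x=\overleftarrow\nu^\epsilon(\cdot|\omega(0)=x)$.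 The time-reversed process is a weak solution of the SDE with drift $-b^\epsilon(x)+\epsilon\nabla\log\rho^\epsilon(T-t,x)$ and noise $\sqrt\epsilon\,d\widetilde B$, and for a.e. $x$ the measures $\nu^\epsilon_x$, $\overleftarrow\nu^\epsilon_x$ and the law $\mu^\epsilon_x$ of $x+\sqrt\epsilon B$ are mutually equivalent, with $\frac{d\nu_x^\epsilon}{d\mu_x^\epsilon}$, $\frac{d\overleftarrow\nu_x^\epsilon}{d\mu_x^\epsilon}$ given by Girsanov's formula $\exp(\frac1\epsilon\int\beta\cdot d\omega-\frac1{2\epsilon}\int|\beta|^2dt)$ for the respective drifts $\beta$. *)

(* Defs.v *)
(* Path-space measures for diffusions with additive noise on R^d, over the real
   numbers of MathComp-Analysis. *)
From HB Require Import structures.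
From mathcomp Require Import all_boot all_order all_algebra.
From mathcomp Require Import all_classical all_reals all_analysis.
From mathcomp Require Import measurable_realfun ring lra.

Set Implicit Arguments.
Unset Strict Implicit.
Unset Printing Implicit Defensive.

Import Order.TTheory GRing.Theory Num.Theory.
Import numFieldNormedType.Exports.

Local Open Scope classical_set_scope.
Local Open Scope ring_scope.

(* The Borel sigma-algebra on matrices; R^d is 'rV[R]_d. *)
Definition mx_open {R : realType} {m n : nat} : set (set 'M[R]_(m, n)) := open.

HB.instance Definition _ (R : realType) (m n : nat) :=
  @isMeasurable.Build (sigma_display (@mx_open R m n)) 'M[R]_(m, n)
    <<s mx_open >> (@sigma_algebra0 _ setT _)
    (@sigma_algebraC 'M[R]_(m, n) _) (@sigma_algebra_bigcup _ setT _).

Section borel_matrix.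
Context (R : realType).

Lemma open_measurable_mx m n (A : set 'M[R]_(m, n)) : open A -> measurable A.
Proof. exact: sub_sigma_algebra. Qed.

Lemma measurable_entry m n (i : 'I_m) (j : 'I_n) :
  measurable_fun [set: 'M[R]_(m, n)] (fun M => M i j).
Proof.
apply: (measurability _ (RGenOInfty.measurableE R)) => _ [_ [a ->] <-].
rewrite setTI; apply: open_measurable_mx.
have oa : open [set x : R | a < x] by exact: open_gt.
rewrite (_ : _ @^-1` _ = (fun M : 'M[R]_(m, n) => M i j) @^-1` [set x | a < x]).
  by apply: open_comp oa => M _; exact: coord_continuous.
by apply/seteqP; split => M /=; rewrite in_itv/= andbT.
Qed.

Lemma measurable_fun_mx d (T : measurableType d) m n (f : T -> 'M[R]_(m, n)) :
  (forall i j, measurable_fun setT (fun x => f x i j)) -> measurable_fun setT f.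
Proof.
move=> mf.
apply: (measurability _ (erefl : measurable = <<s mx_open >>)) => // _ [A oA <-].
rewrite setTI.
pose box (p : 'M[rat]_(m, n) * rat) : set 'M[R]_(m, n) :=
  [set M | forall i j, M i j \in `]ratr (p.1 i j) - ratr p.2, ratr (p.1 i j) + ratr p.2[].
pose F p := if `[< box p `<=` A >] then f @^-1` box p else set0.
have -> : f @^-1` A = \bigcup_p F p.
  apply/seteqP; split => [x Afx|x [p _]]; last first.
    by rewrite /F; case: asboolP => // + bp; exact.
  have [e /= e0 eA] : nbhs_ball (f x) A.
    by rewrite nbhs_ballE; exact: open_nbhs_nbhs.
  have [q qe] : exists q : rat, 0 < (ratr q : R) < e / 2.
    have [q] := @rat_in_itvoo R 0 (e / 2) (divr_gt0 e0 (ltr0Sn _ 1)).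
    by rewrite in_itv /= => qe; exists q.
  have [q0 q2] := andP qe.
  have cP i j : exists r : rat, (ratr r : R) \in `]f x i j - ratr q, f x i j + ratr q[.
    apply: rat_in_itvoo.
    by rewrite ltrBlDr -addrA ltrDl addr_gt0.
  pose c := \matrix_(i, j) xchoose (cP i j).
  have cE i j : (ratr (c i j) : R) \in `]f x i j - ratr q, f x i j + ratr q[.
    by rewrite mxE; exact: xchooseP (cP i j).
  exists (c, q) => //; rewrite /F; case: asboolP => [_|]; last first.
    case=> M /= bM; apply: eA; split => // i j; rewrite /ball /= distrC ltr_norml.
    have := bM i j; have := cE i j; rewrite !in_itv /= => /andP[? ?] /andP[? ?].
    by apply/andP; split; lra.
  move=> i j /=; have := cE i j; rewrite !in_itv /= => /andP[? ?].
  by apply/andP; split; lra.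
apply: countable_bigcupT_measurable => [|p]; first exact: countableP.
rewrite /F; case: asboolP => // _.
rewrite (_ : _ @^-1` _ = \bigcap_(ij : 'I_m * 'I_n) ((fun x => f x ij.1 ij.2) @^-1`
   `]ratr (p.1 ij.1 ij.2) - ratr p.2, ratr (p.1 ij.1 ij.2) + ratr p.2[)); last first.
  by apply/seteqP; split => [x fx [i j] _|x fx i j] /=; [exact: fx|exact: (fx (i, j))].
apply: fin_bigcap_measurable => // -[i j] _.
by rewrite -[X in measurable X]setTI; exact: mf.
Qed.
End borel_matrix.

Section lebesgue_rV.
Context (R : realType).

Definition rV_cons n (p : R * 'rV[R]_n) : 'rV[R]_n.+1 :=
  \row_i (if unlift ord0 i is Some j then p.2 ord0 j else p.1).

Definition rV_uncons n (x : 'rV[R]_n.+1) : R * 'rV[R]_n :=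
  (x ord0 ord0, \row_j x ord0 (lift ord0 j)).

Lemma rV_consK n : cancel (@rV_cons n) (@rV_uncons n).
Proof.
case=> a y; rewrite /rV_uncons mxE unlift_none; congr (_, _).
by apply/rowP => j; rewrite !mxE liftK.
Qed.

Lemma measurable_rV_cons n : measurable_fun setT (@rV_cons n).
Proof.
apply: measurable_fun_mx => i j; case: (unliftP ord0 j) => [k ->|->].
  apply: (eq_measurable_fun ((fun M : 'rV[R]_n => M ord0 k) \o snd)).
    by move=> p _ /=; rewrite mxE liftK.
  by apply: measurableT_comp => //; exact: measurable_entry.
by apply: (eq_measurable_fun fst) => // p _; rewrite mxE unlift_none.
Qed.

Lemma measurable_rV_uncons n : measurable_fun setT (@rV_uncons n).
Proof.
apply/measurable_fun_pairP; split; first exact: measurable_entry.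
apply: measurable_fun_mx => i j.
apply: (eq_measurable_fun (fun x : 'rV[R]_n.+1 => x ord0 (lift ord0 j))).
  by move=> x _ /=; rewrite mxE.
exact: measurable_entry.
Qed.

Section step.
Context (n : nat) (mu : {sigma_finite_measure set 'rV[R]_n -> \bar R}).

Definition lebesgue_cons : set 'rV[R]_n.+1 -> \bar R :=
  pushforward (@lebesgue_measure R \x mu)%E (@rV_cons n).

Let m : {measure set 'rV[R]_n.+1 -> \bar R} :=
  measure_function_pushforward__canonical__measure_function_Measure
    (@lebesgue_measure R \x mu)%E (@measurable_rV_cons n).

HB.instance Definition _ := isMeasure.Build _ _ _ lebesgue_cons
  (measure0 m) (measure_ge0 m) (@measure_semi_sigma_additive _ _ _ m).

Let lebesgue_cons_sigma_finite : sigma_finite setT lebesgue_cons.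
Proof.
have /sigma_finiteP[F [TF ndF Foo]] := sigma_finiteT (@lebesgue_measure R).
have /sigma_finiteP[G [TG ndG Goo]] := sigma_finiteT mu.
exists (fun k => @rV_uncons n @^-1` (F k `*` G k)).
  apply/esym; rewrite -subTset => x _.
  have [k _ Fk] : (\bigcup_k F k) (rV_uncons x).1 by rewrite -TF.
  have [l _ Gl] : (\bigcup_k G k) (rV_uncons x).2 by rewrite -TG.
  exists (maxn k l) => //; split.
    by move: Fk; exact/subsetPset/ndF/leq_maxl.
  by move: Gl; exact/subsetPset/ndG/leq_maxr.
move=> k; have [mF Fk] := Foo k; have [mG Gk] := Goo k; split.
  rewrite -[X in measurable X]setTI; apply: measurable_rV_uncons => //.
  exact: measurableX.
rewrite /lebesgue_cons /pushforward -comp_preimage (_ : _ \o _ = id)//.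
  by rewrite preimage_id product_measure1E// lte_mul_pinfty// ge0_fin_numE.
by apply/funext => p; exact: rV_consK.
Qed.

HB.instance Definition _ :=
  @Measure_isSigmaFinite.Build _ _ _ lebesgue_cons lebesgue_cons_sigma_finite.

Definition lebesgue_cons_measure :
  {sigma_finite_measure set 'rV[R]_n.+1 -> \bar R} := lebesgue_cons.

End step.

Fixpoint lebesgue_rV n : {sigma_finite_measure set 'rV[R]_n -> \bar R} :=
  match n with
  | 0 => \d_(0 : 'rV[R]_0)
  | n'.+1 => lebesgue_cons_measure (lebesgue_rV n')
  end.

Lemma lebesgue_rV_prod n (A : 'I_n -> set R) :
  (forall i, measurable (A i)) ->
  lebesgue_rV n [set x | forall i, A i (x ord0 i)] =
  (\prod_i lebesgue_measure (A i))%E.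
Proof.
elim: n A => [|n IH] A mA.
  rewrite big_ord0 [LHS]diracE (_ : [set _ | _] = setT) ?in_setT//.
  by apply/seteqP; split => // x _ [].
rewrite big_ord_recl -IH//= /lebesgue_cons /pushforward.
have mbox : measurable [set x : 'rV[R]_n | forall i, A (lift ord0 i) (x ord0 i)].
  rewrite (_ : mkset _ =
    \bigcap_i ((fun x : 'rV[R]_n => x ord0 i) @^-1` A (lift ord0 i))); last first.
    by apply/seteqP; split => [x Ax i _|x Ax i]; exact: Ax.
  apply: fin_bigcap_measurable => // i _.
  by rewrite -[X in measurable X]setTI; exact: measurable_entry.
rewrite -product_measure1E//.
  congr product_measure1; apply/seteqP; split => [p Ap|p [p1 p2] i] /=.
    split; first by have := Ap ord0; rewrite mxE unlift_none.
    by move=> i; have := Ap (lift ord0 i); rewrite mxE liftK.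
  by rewrite mxE; case: unliftP => [j ->|->]; [exact: p2|exact: p1].

exact: mA.
Qed.

End lebesgue_rV.

Section path_space.
Context {R : realType}.

(* C([0, T]; R^d): a path on [0, T] is represented by the continuous function
   on the line that extends it by its end values. *)
Definition clamp (T t : R) : R := Num.max 0 (Num.min T t).

Record Cpath (T : R) (d : nat) := CPath {
  path_fun :> R -> 'rV[R]_d ;
  path_continuous : continuous path_fun ;
  path_clamp : forall t, path_fun t = path_fun (clamp T t) }.

Context {T : R} {d : nat}.

Lemma zero_path_continuous : continuous (fun _ : R => 0 : 'rV[R]_d).
Proof. by move=> t; exact: cvg_cst. Qed.

Definition zero_path : Cpath T d :=
  @CPath T d (fun=> 0) zero_path_continuous (fun=> erefl).

HB.instance Definition _ := gen_eqMixin (Cpath T d).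
HB.instance Definition _ := gen_choiceMixin (Cpath T d).
HB.instance Definition _ := isPointed.Build (Cpath T d) zero_path.

Definition cylinder : set (set (Cpath T d)) :=
  [set A | exists t, exists2 B, measurable B & A = [set w : Cpath T d | B (w t)]].

HB.instance Definition _ :=
  @isMeasurable.Build (sigma_display cylinder) (Cpath T d) <<s cylinder >>
    (@sigma_algebra0 _ setT _) (@sigma_algebraC (Cpath T d) _)
    (@sigma_algebra_bigcup _ setT _).

Lemma reverse_continuous (w : Cpath T d) : continuous (fun t => w (T - t)).
Proof.
move=> t; apply: (@continuous_comp _ _ _ (fun s => T - s) w).
  by apply: cvgB; [exact: cvg_cst|exact: cvg_id].
exact: path_continuous.
Qed.

Lemma reverse_clamp (w : Cpath T d) t : w (T - t) = w (T - clamp T t).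
Proof.
rewrite path_clamp [RHS]path_clamp; congr (w _); rewrite /clamp.
have [T0|T0] := ltP T 0.
  have max0 x : Num.max 0 (Num.min T x) = 0.
    by apply/max_idPl; rewrite ge_min (ltW T0).
  by rewrite !max0.
case: (leP T t) => [Tt|tT].
  rewrite (max_idPr T0) subrr (min_idPr T0) maxxx; apply/max_idPl.
  by rewrite ge_min subr_le0 Tt orbT.
case: (leP 0 t) => [//|t0]; rewrite subr0 minxx (min_idPl _)//; lra.
Qed.

Definition reverse (w : Cpath T d) : Cpath T d :=
  @CPath T d (fun t => w (T - t)) (@reverse_continuous w) (@reverse_clamp w).

End path_space.

Section calculus.
Context {R : realType} {d : nat}.
Local Notation E := 'rV[R]_d.
Implicit Types (f : E -> R) (F : E -> E) (x : E).

Definition dotv (u v : E) : R := \sum_i u ord0 i * v ord0 i.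

Definition basis_vec (i : 'I_d) : E := delta_mx ord0 i.

Definition grad f x : E := \row_i 'D_(basis_vec i) f x.

Definition div F x : R := \sum_i 'D_(basis_vec i) (fun y => F y ord0 i) x.

Definition C1 F := forall i,
  (forall x, derivable F x (basis_vec i)) /\ continuous ('D_(basis_vec i) F).

(* Two-sided on ]0, T[ and one-sided at 0 and T. *)
Definition time_quotients (T : R) (rho : R -> E -> R) t x : set_system R :=
  (fun s => (s - t)^-1 * (rho s x - rho t x)) @ within `[0, T] t^'.

Definition dtime (T : R) (rho : R -> E -> R) t x : R :=
  lim (time_quotients T rho t x).

Definition C12 (T : R) (rho : R -> E -> R) :=
  let slab : set (R * E) := `[0, T] `*` setT in
  let cont (g : R -> E -> R) := {within slab, continuous (fun p => g p.1 p.2)} in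
  let D i (g : R -> E -> R) t := 'D_(basis_vec i) (g t) in
  [/\ cont rho,
      (forall t x, 0 <= t <= T -> cvg (time_quotients T rho t x)) /\
        cont (dtime T rho),
      forall i, (forall t x, 0 <= t <= T -> derivable (rho t) x (basis_vec i)) /\
        cont (D i rho) &
      forall i j,
        (forall t x, 0 <= t <= T -> derivable (D i rho t) x (basis_vec j)) /\
        cont (D j (D i rho))].

End calculus.

Section diffusions.
Context {R : realType} {T : R} {d : nat}.
Local Notation E := 'rV[R]_d.
Local Notation path := (Cpath T d).
Local Notation leb := (@lebesgue_measure R).
Implicit Types (eps : R) (beta F : R -> E -> E) (nu mu : set path -> \bar R).

Definition filtration dO (O : measurableType dO) (G : R -> set (set O)) :=
  [/\ forall t, sigma_algebra setT (G t),
      forall t, G t `<=` measurable &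
      forall s t, s <= t -> G s `<=` G t].

Definition adapted dO (O : measurableType dO) (G : R -> set (set O))
    (X : O -> path) :=
  forall t, 0 <= t <= T -> forall A, measurable A -> G t [set o | A (X o t)].

(* Standard d-dimensional Brownian motion on [0, T] relative to G: the increment
   over [s, t] is independent of G s and has law N(0, (t - s) I_d). *)
Definition brownian dO (O : measurableType dO) (P : probability O R)
    (G : R -> set (set O)) (B : O -> path) :=
  [/\ {ae P, forall o, B o 0 = 0},
      adapted G B &
      forall s t, 0 <= s -> s < t -> t <= T ->
      forall A, G s A -> forall C : 'I_d -> set R, (forall i, measurable (C i)) ->
        let N := normal_prob 0 (Num.sqrt (t - s)) in
        P (A `&` [set o | forall i, C i ((B o t - B o s) ord0 i)]) =
        (P A * \prod_i N (C i))%E].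

Definition time_integral (g : R -> R) (t : R) : R :=
  \int[leb]_(s in `[0, t]) g s.

(* nu is the law of a weak solution, on [0, T], of
   dX = beta(t, X) dt + sqrt eps dB. *)
Definition weak_solution_law eps beta nu :=
  exists dO (O : measurableType dO) (P : probability O R)
    (G : R -> set (set O)) (B : O -> path) (X : {RV P >-> path}),
  [/\ filtration G, brownian P G B, adapted G X,
      {ae P, forall o, forall t, 0 <= t <= T ->
        X o t = X o 0 +
          \row_i time_integral (fun s => beta s (X o s) ord0 i) t +
          Num.sqrt eps *: B o t} &
      forall A, measurable A -> nu A = distribution P X A].

(* mu is the law of x + sqrt eps B. *)
Definition scaled_brownian_law eps (x : E) mu :=
  exists dO (O : measurableType dO) (P : probability O R)
    (G : R -> set (set O)) (B : O -> path) (X : {RV P >-> path}),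
  [/\ filtration G, brownian P G B,
      forall o t, 0 <= t <= T -> X o t = x + Num.sqrt eps *: B o t &
      forall A, measurable A -> mu A = distribution P X A].

Definition density_at (t : R) nu (f : E -> R) := forall C : set E, measurable C ->
  nu [set w : path | C (w t)] = (\int[lebesgue_rV R d]_(x in C) (f x)%:E)%E.

(* k is a regular version of the conditional law nu(. | w(0) = x). *)
Definition conditional_law nu (k : R.-pker E ~> path) :=
  forall (A : set path) (C : set E), measurable A -> measurable C ->
    let start_in_C := [set w : path | C (w 0)] in
    nu (A `&` start_in_C) = (\int[nu]_(w in start_in_C) k (w 0%R) A)%E.

Definition mutually_equivalent mu nu := mu `<< nu /\ nu `<< mu.

Definition ito_sum F (s : seq R) (w : path) : R :=
  let u := nth T (0 :: s) in
  \sum_(0 <= k < size s) dotv (F (u k) (w (u k))) (w (u k.+1) - w (u k)).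

Definition mesh_lt (s : seq R) (delta : R) :=
  let u := nth T (0 :: s) in
  forall k, (k < size s)%N -> u k.+1 - u k < delta.

(* I is a version of the Ito integral of F(t, w(t)) . dw(t) over [0, T]: the
   limit in nu-probability of the left-point sums as the mesh tends to 0, which
   characterizes it for F continuous and w a continuous semimartingale. *)
Definition ito_integral nu F (I : path -> R) :=
  measurable_fun setT I /\
  forall e eta : R, 0 < e -> 0 < eta -> exists2 delta, 0 < delta &
    forall s, itv_partition 0 T s -> mesh_lt s delta ->
      (nu [set w | (e <= `|ito_sum F s w - I w|)%R] < eta%:E)%E.

Definition stratonovich_integral eps nu F (J : path -> R) :=
  exists2 I, ito_integral nu F I &
    forall w, J w = I w + eps / 2 * time_integral (fun t => div (F t) (w t)) T.

(* dnu/dmu = exp(eps^-1 \int beta . dw - (2 eps)^-1 \int |beta|^2 dt). *)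
Definition girsanov_density eps beta nu mu :=
  exists2 I, ito_integral mu beta I &
    forall A, measurable A ->
      nu A = (\int[mu]_(w in A)
        (expR (eps^-1 * I w - (2 * eps)^-1 *
           time_integral (fun t => dotv (beta t (w t)) (beta t (w t))) T))%R%:E)%E.

Definition grad_log (f : E -> R) : E -> E := grad (fun x => ln (f x)).

Definition current eps (b : E -> E) (rho : R -> E -> R) t x : E :=
  rho t x *: b x - (eps / 2) *: grad (rho t) x.

Definition reverse_drift eps (b : E -> E) (rho : R -> E -> R) t x : E :=
  - b x + eps *: grad_log (rho (T - t)) x.

Definition fokker_planck eps (b : E -> E) (rho : R -> E -> R) :=
  forall t x, 0 <= t <= T ->
    dtime T rho t x =
    - div (fun y => rho t y *: (b y - (eps / 2) *: grad_log (rho t) y)) x.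

(* S is a version of s_tot(T, w) - s_tot(0, w). *)
Definition total_entropy_production eps (b : E -> E) (rho : R -> E -> R) nu
    (S : path -> R) :=
  let F t x := (2 / eps) *: ((rho (T - t) x)^-1 *: current eps b rho (T - t) x) in
  exists2 J, stratonovich_integral eps nu F J &
    forall w, S w =
      time_integral (fun t => dtime T rho (T - t) (w t) / rho (T - t) (w t)) T + J w.

End diffusions.

(* Main.v *)
(* Girsanov's formula applied to nu_x and to its time reversal (drifts b and
   b' = - b + eps grad log rho(T - t)) makes d rev_x / d nu_x the exponential of
   minus eps^-1 int (b - b') . dw - (2 eps)^-1 int (|b|^2 - |b'|^2) dt.  The
   integrand of the Stratonovich part of s_tot is exactly (b - b') / eps, and by
   the Fokker-Planck equation the remaining time integrals, Stratonovich
   correction included, add up to the quadratic term.  Hence Delta s_tot is the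
   logarithm of d nu_x / d rev_x path by path, no Ito formula being needed, and
   E_{nu_x}[exp(- Delta s_tot)] is the total mass of rev_x; it remains to average
   over the initial point.  The Ito integrals given under each Wiener measure mu_x
   are glued into one under nu: left-point sums are Cauchy in mu_x-probability,
   hence in nu_x-probability by absolute continuity, hence in nu-probability by
   dominated convergence in x. *)
Require Import Defs.
From HB Require Import structures.
From mathcomp Require Import all_boot all_order all_algebra.
From mathcomp Require Import all_classical all_reals all_analysis.
From mathcomp Require Import measurable_realfun ring lra.

Set Implicit Arguments.
Unset Strict Implicit.
Unset Printing Implicit Defensive.

Import Order.TTheory GRing.Theory Num.Theory.
Import numFieldNormedType.Exports.

Local Open Scope classical_set_scope.
Local Open Scope ring_scope.

(** * Convergence in probability: stability, uniqueness, completeness *)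

Section convergence_in_probability.
Context dO (O : measurableType dO) (R : realType) (P : probability O R).
Implicit Types (X : nat -> O -> R) (Y Z : O -> R) (e : R).

Lemma measurable_dist_ge Y Z e : measurable_fun setT Y -> measurable_fun setT Z ->
  measurable [set w | e <= `|Y w - Z w|].
Proof.
move=> mY mZ; rewrite -[X in measurable X]setTI.
apply: measurable_fun_le => //; apply: measurableT_comp => //.
exact: measurable_funB.
Qed.

Definition cvg_in_prob X Y := forall e, 0 < e ->
  P [set w | e <= `|X n w - Y w|] @[n --> \oo] --> 0%E.

(** Finiteness of the total mass makes every value a real number, so that convergence in the
    extended reals becomes an ordinary epsilon statement. *)
Lemma finite_measure_cvg0P (mu : {measure set O -> \bar R}) (A : (set O)^nat) :
  (mu setT < +oo)%E -> (forall n, measurable (A n)) ->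
  mu (A n) @[n --> \oo] --> 0%E <->
  forall eta : R, 0 < eta -> \forall n \near \oo, (mu (A n) < eta%:E)%E.
Proof.
move=> muT mA.
have fin n : mu (A n) \is a fin_num.
  rewrite ge0_fin_numE//; apply: le_lt_trans muT.
  by apply: le_measure; rewrite ?inE.
have E n eta : (mu (A n) < eta%:E)%E = (`|0 - fine (mu (A n))| < eta).
  by rewrite sub0r normrN ger0_norm ?fine_ge0// -lte_fin fineK.
split=> [/fine_cvgP[_ /cvgrPdist_lt PA] eta eta0|PA].
  by apply: filterS (PA _ eta0) => n; rewrite E.
apply/fine_cvgP; split; first exact: nearW.
by apply/cvgrPdist_lt => eta eta0; apply: filterS (PA _ eta0) => n; rewrite E.
Qed.

Lemma prob_cvg0P (A : (set O)^nat) : (forall n, measurable (A n)) ->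
  P (A n) @[n --> \oo] --> 0%E <->
  forall eta : R, 0 < eta -> \forall n \near \oo, (P (A n) < eta%:E)%E.
Proof. by apply: finite_measure_cvg0P; rewrite -ge0_fin_numE// fin_num_measure. Qed.

(** A union bound with [eta] split in half. The Cauchy property, the scaled difference and
    uniqueness below all reduce to it by finding the right covering. *)
Lemma prob_cvg0_cover (A B C : (set O)^nat) :
  (forall n, measurable (A n)) -> (forall n, measurable (B n)) ->
  (forall n, measurable (C n)) -> (forall n, A n `<=` B n `|` C n) ->
  P (B n) @[n --> \oo] --> 0%E -> P (C n) @[n --> \oo] --> 0%E ->
  P (A n) @[n --> \oo] --> 0%E.
Proof.
move=> mA mB mC ABC B0 C0; apply/prob_cvg0P => // eta eta0.
have eta20 : 0 < eta / 2 by rewrite divr_gt0.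
move/prob_cvg0P : B0 => /(_ mB _ eta20); move/prob_cvg0P : C0 => /(_ mC _ eta20).
apply: filterS2 => n Cn Bn; rewrite [eta]splitr EFinD.
apply: le_lt_trans (lteD Bn Cn); apply: le_trans (measureU2 _ _ _) => //.
by apply: le_measure (ABC n); rewrite inE//; exact: measurableU.
Qed.

(** Dominated convergence for the indicators of the [A n], with the constant 1 as dominating
    function. *)
Lemma prob_indic_cvg0 (A : (set O)^nat) : (forall n, measurable (A n)) ->
  {ae P, forall w, \forall n \near \oo, ~ A n w} -> P (A n) @[n --> \oo] --> 0%E.
Proof.
move=> mA Aev.
have [||||| _ _] := @dominated_convergence _ _ _ P setT measurableT
    (fun n w => (\1_(A n) w)%:E) (cst 0%E) (cst 1%E).
- by move=> n; apply/measurable_EFinP; exact: measurable_indic.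
- exact: measurable_cst.
- apply: filterS Aev => w [N _ hN] _; apply: cvg_near_cst.
  exists N => // n Nn /=; rewrite indicE memNset//; exact: hN.
- exact: finite_measure_integrable_cst.
- by apply: aeW => w n _ /=; rewrite lee_fin ger0_norm// indicE; case: (_ \in _).
rewrite integral_cst// mul0e.
by under eq_fun do rewrite integral_indic// setIT.
Qed.

Lemma ae_cvg_in_prob X Y :
  (forall n, measurable_fun setT (X n)) -> measurable_fun setT Y ->
  {ae P, forall w, X n w @[n --> \oo] --> Y w} -> cvg_in_prob X Y.
Proof.
move=> mX mY XY e e0; apply: prob_indic_cvg0.
  by move=> n; exact: measurable_dist_ge.
apply: filterS XY => w /cvgrPdist_lt/(_ e e0).
by apply: filterS => n; rewrite distrC => + /=; rewrite ltNge => /negP.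
Qed.

Lemma dist_ge_split e (x y z : R) :
  e <= `|x - z| -> e / 2 <= `|x - y| \/ e / 2 <= `|z - y|.
Proof.
move=> exz; have [|h] := leP (e / 2) `|x - y|; [by left|right].
have := ler_distD y x z; rewrite [`|y - z|]distrC; lra.
Qed.

Lemma cvg_in_prob_cauchy X X' Y :
  (forall n, measurable_fun setT (X n)) -> (forall n, measurable_fun setT (X' n)) ->
  measurable_fun setT Y -> cvg_in_prob X Y -> cvg_in_prob X' Y ->
  forall e, 0 < e -> P [set w | e <= `|X n w - X' n w|] @[n --> \oo] --> 0%E.
Proof.
move=> mX mX' mY XY X'Y e e0; have e20 : 0 < e / 2 by rewrite divr_gt0.
apply: prob_cvg0_cover (XY _ e20) (X'Y _ e20);
  try by move=> n; exact: measurable_dist_ge.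
by move=> n w; exact: dist_ge_split.
Qed.

Lemma cvg_in_prob_scaleB (c : R) X X' Y Y' : 0 < c ->
  (forall n, measurable_fun setT (X n)) -> (forall n, measurable_fun setT (X' n)) ->
  measurable_fun setT Y -> measurable_fun setT Y' ->
  cvg_in_prob X Y -> cvg_in_prob X' Y' ->
  cvg_in_prob (fun n w => c * (X n w - X' n w)) (fun w => c * (Y w - Y' w)).
Proof.
move=> c0 mX mX' mY mY' XY X'Y' e e0.
have e20 : 0 < e / c / 2 by rewrite !divr_gt0.
have mc (f g : O -> R) : measurable_fun setT f -> measurable_fun setT g ->
    measurable_fun setT (fun w => c * (f w - g w)).
  by move=> mf mg; apply: measurable_funM => //; exact: measurable_funB.
apply: prob_cvg0_cover (XY _ e20) (X'Y' _ e20).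
- by move=> n; apply: measurable_dist_ge; exact: mc.
- by move=> n; exact: measurable_dist_ge.
- by move=> n; exact: measurable_dist_ge.
move=> n w /=; rewrite -mulrBr normrM gtr0_norm// mulrC -ler_pdivrMr// => h.
have : e / c <= `|(X n w - Y w) - (X' n w - Y' w)|.
  suff -> : X n w - Y w - (X' n w - Y' w) = X n w - X' n w - (Y w - Y' w) by [].
  by ring.
by move=> /(@dist_ge_split _ _ 0); rewrite !subr0.
Qed.

Lemma cvg_in_prob_unique X Y Z :
  (forall n, measurable_fun setT (X n)) -> measurable_fun setT Y ->
  measurable_fun setT Z -> cvg_in_prob X Y -> cvg_in_prob X Z ->
  {ae P, forall w, Y w = Z w}.
Proof.
move=> mX mY mZ XY XZ.
have P0 e : 0 < e -> P [set w | e <= `|Y w - Z w|] = 0%E.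
  move=> e0; have e20 : 0 < e / 2 by rewrite divr_gt0.
  (* The probability does not depend on the index; as a constant sequence tending to 0 it is 0. *)
  have : P [set w | e <= `|Y w - Z w|] @[_ --> \oo] --> 0%E.
    apply: prob_cvg0_cover (XY _ e20) (XZ _ e20);
      try by move=> n; exact: measurable_dist_ge.
    by move=> n w /= /(@dist_ge_split _ _ (X n w)); rewrite ![`|X n w - _|]distrC.
  by move=> /cvg_lim <-//; rewrite lim_cst.
have : {ae P, forall w, forall n, ~ (n.+1%:R^-1 <= `|Y w - Z w|)}.
  apply: ae_foralln => n; exists [set w | n.+1%:R^-1 <= `|Y w - Z w|]; split.
  - exact: measurable_dist_ge.
  - by apply: P0; rewrite invr_gt0.
  - by move=> w /= /contrapT.
apply: filterS => w h; apply/eqP; rewrite -subr_eq0 -normr_eq0.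
apply/negPn/negP => yz0.
have : 0 < `|Y w - Z w| by rewrite lt_neqAle eq_sym yz0 normr_ge0.
move=> /ltr_add_invr[k]; rewrite add0r => /ltW; exact: h.
Qed.

(** Borel-Cantelli: the probabilities are bounded by the terms of a geometric series, so the limsup
    of the exceptional sets is null. *)
Lemma fast_in_prob_ae (X Z : nat -> O -> R) :
  (forall n, measurable_fun setT (X n)) -> (forall n, measurable_fun setT (Z n)) ->
  (forall n, P [set w | (2^-1 ^+ n.+1 <= `|X n w - Z n w|)%R] <= (2^-1 ^+ n.+1)%:E)%E ->
  {ae P, forall w, \forall n \near \oo, `|X n w - Z n w| < 2^-1 ^+ n.+1}.
Proof.
move=> mX mZ fastXZ.
pose A n := [set w | 2^-1 ^+ n.+1 <= `|X n w - Z n w|].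
have mA n : measurable (A n) by exact: measurable_dist_ge.
exists (lim_sup_set A); split.
- apply: bigcap_measurable => // n _; exact: bigcup_measurable.
- apply: lim_sup_set_cvg0 => //.
  have h := @cvg_geometric_eseries_half R 1 0.
  apply: (@le_lt_trans _ _ (\sum_(0 <= n <oo) (1 / (2 ^ (n + 1))%:R : R)%:E)%E).
    by apply: lee_nneseries => // n _; rewrite div1r natrX addn1 -exprVn; exact: fastXZ.
  by rewrite (cvg_lim _ h)// ltry.
- move=> w /= h n _; apply: contrapT => hn; apply: h; exists n => // k /= nk.
  by rewrite ltNge; apply/negP => hk; apply: hn; exists k.
Qed.

Lemma fast_cauchy_cvg (u : nat -> R) :
  (\forall n \near \oo, `|u n.+1 - u n| < 2^-1 ^+ n.+1) -> cvgn u.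
Proof.
move=> [N _ hN]; apply/cauchy_cvgP; apply: cauchy_exP => e e0.
(* The subtracted power lets the induction on [k] close: each increment uses up exactly the
   difference of two consecutive powers of one half. *)
have bound n k : (N <= n)%N -> `|u (n + k)%N - u n| <= 2^-1 ^+ n - 2^-1 ^+ (n + k).
  move=> Nn; elim: k => [|k IH]; first by rewrite addn0 !subrr normr0.
  rewrite addnS -(subrKA (u (n + k)%N)) (le_trans (ler_normD _ _))//.
  have := hN (n + k)%N (leq_trans Nn (leq_addr _ _)); rewrite /= exprS; lra.
have [M _ hM] : \forall n \near \oo, (2^-1 : R) ^+ n < e.
  have : (2^-1 : R) ^+ n @[n --> \oo] --> 0.
    by apply: cvg_expr; rewrite ger0_norm ?invr_ge0// invf_lt1// ltr1n.
  move=> /cvgrPdist_lt/(_ e e0); apply: filterS => n.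
  by rewrite sub0r normrN ger0_norm// exprn_ge0// invr_ge0.
exists (u (maxn N M)); exists (maxn N M) => // n /= Kn.
rewrite /ball /= distrC -(subnKC Kn).
apply: le_lt_trans (bound _ _ (leq_maxl _ _)) _.
apply: le_lt_trans (hM _ (leq_maxr N M)).
by rewrite lerBlDr lerDl exprn_ge0// invr_ge0.
Qed.

(** Completeness for convergence in probability, in the form of rapidly Cauchy sequences: these
    converge almost everywhere. *)
Lemma fast_cauchy_in_prob_cvg X : (forall n, measurable_fun setT (X n)) ->
  (forall n, P [set w | (2^-1 ^+ n.+1 <= `|X n.+1 w - X n w|)%R] <= (2^-1 ^+ n.+1)%:E)%E ->
  exists2 Y, measurable_fun setT Y & cvg_in_prob X Y.
Proof.
move=> mX fastX.
(* The upper limit is measurable without any convergence; [fine] gives it an arbitrary real value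
   where it is infinite, which happens only on a null set. *)
pose Y w := fine (limn_esup (fun n => (X n w)%:E)).
have mY : measurable_fun setT Y.
  apply: measurableT_comp => //; apply: measurable_fun_limn_esup => n.
  exact/measurable_EFinP.
exists Y => //; apply: ae_cvg_in_prob => //.
have := fast_in_prob_ae (fun n => mX n.+1) mX fastX.
apply: filterS => w /fast_cauchy_cvg cX.
suff -> : Y w = limn (X ^~ w) by exact: cX.
rewrite /Y limn_esup_lim (_ : limn _ = (limn (X ^~ w))%:E)//.
apply/cvg_lim => //; apply: cvg_esups; apply: cvg_EFin => //.
exact: nearW.
Qed.

End convergence_in_probability.

(** * Integration against a mixture of measures *)

Section mixtures.
Local Open Scope ereal_scope.
Context d d' (Y : measurableType d) (Z : measurableType d') (R : realType).
Import HBNNSimple.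

(** Linearity gives the claim for simple functions, and monotone convergence, in the inner and then
    in the outer integral, extends it. It serves both for densities and for the disintegration of
    [nu]. *)
Lemma ge0_integral_mixture (P : {measure set Y -> \bar R})
    (m : Y -> {measure set Z -> \bar R}) (nu : {measure set Z -> \bar R}) f :
  (forall A, measurable A -> measurable_fun setT (m ^~ A)) ->
  (forall A, measurable A -> nu A = \int[P]_y m y A) ->
  measurable_fun setT f -> (forall z, 0 <= f z) ->
  \int[nu]_z f z = \int[P]_y \int[m y]_z f z.
Proof.
move=> mm nuE mf f0.
pose g := nnsfun_approx measurableT mf.
have mg n : measurable_fun setT (EFin \o g n) by exact/measurable_EFinP.
have g0 n z : 0 <= (g n z)%:E by rewrite lee_fin.
have ndg z : {homo (fun n => (g n z)%:E) : a b / (a <= b)%N >-> a <= b}.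
  by move=> a b ab; rewrite lee_fin; exact/lefP/nd_nnsfun_approx.
have limg z : limn (fun n => (g n z)%:E) = f z.
  by apply/cvg_lim => //; exact: cvg_nnsfun_approx.
have step n : \int[nu]_z (g n z)%:E = \int[P]_y \int[m y]_z (g n z)%:E.
  transitivity (\sum_(x \in range (g n)) \int[P]_y (x%:E * m y (g n @^-1` [set x]))).
    rewrite integralT_nnsfun sintegralE; apply: eq_fsbigr => r.
    rewrite inE => -[z _ <-]; rewrite nuE//.
    by rewrite ge0_integralZl// ?lee_fin//; exact: mm.
  rewrite -ge0_integral_fsum//.
  - by apply: eq_integral => y _; rewrite integralT_nnsfun sintegralE.
  - by move=> r; apply: measurable_funeM; exact: mm.
  (* A negative [r] is not a value of the nonnegative function [g n], so its level set is empty. *)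
  - move=> r y _; have [r0|r0] := leP 0%R r; first by rewrite mule_ge0.
    by rewrite preimage_nnfun0// measure0 mule0.
transitivity (limn (fun n => \int[nu]_z (g n z)%:E)).
  rewrite -monotone_convergence//.
  by apply: eq_integral => z _; rewrite limg.
under eq_fun do rewrite step.
rewrite -monotone_convergence//.
- apply: eq_integral => y _; rewrite -monotone_convergence//.
  by apply: eq_integral => z _; rewrite limg.
- by move=> n; apply: measurable_fun_integral_kernel => //; exact: mg.
- by move=> n y _; apply: integral_ge0.
- move=> y _ a b ab; apply: ge0_le_integral => //; last by move=> z _; exact: ndg.
  + exact: mg.
  + exact: mg.
Qed.

End mixtures.

(** * Change of measure by a real-valued density *)

Section densities.
Context d (T : measurableType d) (R : realType).
Local Open Scope ereal_scope.

(** A measure with density [D] is the mixture, over [mu], of the Dirac masses at [x] scaled by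
    [D x]. *)
Lemma ge0_integral_density (mu nu : {measure set T -> \bar R}) (D : T -> R) f :
  measurable_fun setT D -> (forall x, 0 <= D x)%R ->
  (forall A, measurable A -> nu A = \int[mu]_(x in A) (D x)%:E) ->
  measurable_fun setT f -> (forall x, 0 <= f x) ->
  \int[nu]_x f x = \int[mu]_x ((D x)%:E * f x).
Proof.
move=> mD D0 nuE mf f0.
rewrite (@ge0_integral_mixture _ _ _ _ _ mu
  (fun x => mscale (NngNum (D0 x)) (\d_x : {measure set T -> \bar R})))//.
- apply: eq_integral => x _; rewrite ge0_integral_mscale//.
  by rewrite integral_dirac// diracT mul1e.
- move=> A mA; apply: emeasurable_funM; first exact/measurable_EFinP.
  by apply/measurable_EFinP; exact: measurable_indic.
- move=> A mA; rewrite nuE// integral_mkcond; apply: eq_integral => x _.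
  change (((fun x : T => (D x)%:E) \_ A) x = (D x)%:E * (\1_A x)%:E).
  rewrite patchE indicE; case: (x \in A) => /=.
    by rewrite mule1.
  by rewrite mule0.
Qed.

(** Absolute continuity of the integral of [D], which is integrable because [nu] is finite. *)
Lemma density_cvg0 (mu nu : {measure set T -> \bar R}) (D : T -> R) (A : (set T)^nat) :
  measurable_fun setT D -> (forall x, 0 <= D x)%R ->
  (forall A, measurable A -> nu A = \int[mu]_(x in A) (D x)%:E) ->
  mu setT < +oo -> nu setT < +oo -> (forall n, measurable (A n)) ->
  mu (A n) @[n --> \oo] --> 0 -> nu (A n) @[n --> \oo] --> 0.
Proof.
move=> mD D0 nuE muT nuT mA mu0.
have iD : mu.-integrable setT (EFin \o D).
  apply/integrableP; split; first exact/measurable_EFinP.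
  under eq_integral do rewrite /= ger0_norm//.
  by rewrite -nuE.
apply/finite_measure_cvg0P => // e e0.
have [r [r0 re]] := integral_normr_continuous iD e0.
move/(finite_measure_cvg0P muT mA) : mu0 => /(_ r r0).
apply: filterS => n muA; have := re _ (mA n) muA.
rewrite nuE// /Rintegral; under eq_integral do rewrite ger0_norm//.
rewrite -lte_fin fineK// -nuE// ge0_fin_numE//; apply: le_lt_trans nuT.
by apply: le_measure; rewrite ?inE.
Qed.

End densities.

(** * Directional derivatives reduced to functions of one real variable *)

Section directional_derivatives.
Context (R : realType) (V : normedModType R).
Implicit Types (f g : V -> R) (x v : V).

Lemma derivable_lineP f x v s :
  derivable (fun h : R => f (h *: v + x)) s 1 <-> derivable f (s *: v + x) v.
Proof.
rewrite /derivable (_ : (fun h => _) =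
  (fun h => h^-1 *: ((f \o shift (s *: v + x)) (h *: v) - f (s *: v + x))))//.
by apply/funext => h /=; rewrite -[h *: 1]/(h * 1) mulr1 scalerDl addrA.
Qed.

Lemma derive_line f x v s :
  'D_1 (fun h : R => f (h *: v + x)) s = 'D_v f (s *: v + x).
Proof.
rewrite /derive (_ : (fun h => _) =
  (fun h => h^-1 *: ((f \o shift (s *: v + x)) (h *: v) - f (s *: v + x))))//.
by apply/funext => h /=; rewrite -[h *: 1]/(h * 1) mulr1 scalerDl addrA.
Qed.

Lemma is_derive_ln f x v : derivable f x v -> 0 < f x ->
  is_derive x v (fun y => ln (f y)) ((f x)^-1 * 'D_v f x).
Proof.
move=> df fx0.
have dl : is_derive (0 : R) (1 : R) (fun h : R => f (h *: v + x)) ('D_v f x).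
  have E : 0 *: v + x = x by rewrite scale0r add0r.
  apply: DeriveDef; first by apply/derivable_lineP; rewrite E.
  by rewrite derive_line E.
have fx0' : 0 < f (0 *: v + x) by rewrite scale0r add0r.
have dln := is_derive1_ln fx0'.
have [d1 d2] := @is_derive1_comp R (@ln R) (fun h => f (h *: v + x)) 0 _ _ dln dl.
rewrite /comp /= in d1 d2.
have E : x = 0 *: v + x by rewrite scale0r add0r.
split; first by rewrite [X in derivable _ X _]E; apply/derivable_lineP.
by rewrite [X in 'D_v _ X = _]E -derive_line; rewrite d2 -E mulrC.
Qed.

(** The mean value theorem on the line through [x] with direction [v]. *)
Lemma line_increment_le f x v M a c : a <= c ->
  (forall s, derivable f (s *: v + x) v) ->
  (forall s, a <= s <= c -> `|'D_v f (s *: v + x)| <= M) ->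
  `|f (c *: v + x) - f (a *: v + x)| <= M * (c - a).
Proof.
move=> ac df dM.
have di s : is_derive (s : R) (1 : R) (fun h : R => f (h *: v + x)) ('D_v f (s *: v + x)).
  by apply: DeriveDef; [apply/derivable_lineP|rewrite derive_line].
have cl : {within `[a, c], continuous (fun h : R => f (h *: v + x))}.
  by apply: derivable_within_continuous => s _; exact: ex_derive.
have [s /[!in_itv]/= /dM sM ->] := MVT_segment ac (fun s _ => di s) cl.
by rewrite normrM [X in _ * X]ger0_norm ?subr_ge0// ler_wpM2r// subr_ge0.
Qed.

End directional_derivatives.

(** * Gradient, divergence and continuity on row vectors *)

Section row_calculus.
Context (R : realType) (d : nat).
Local Notation E := 'rV[R]_d.
Implicit Types (f : E -> R) (F : E -> E) (x : E).

(** [C1] speaks of partial derivatives only, so continuity has to be proved. Near [x] the partials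
    are bounded by a common [M], and moving from [x] to [y] one coordinate at a time gives a local
    Lipschitz bound. *)
Lemma continuous_of_partials f :
  (forall i x, derivable f x (basis_vec i)) ->
  (forall i, continuous ('D_(basis_vec i) f)) -> continuous f.
Proof.
move=> df cdf x.
pose M := \sum_(i < d) (`|'D_(basis_vec i) f x| + 1).
have leM i : `|'D_(basis_vec i) f x| + 1 <= M.
  rewrite /M (bigD1 i)//= lerDl sumr_ge0// => j _; exact: addr_ge0.
have M0 : 0 <= M by apply: sumr_ge0 => i _; exact: addr_ge0.
have : \forall y \near x, forall i, `|'D_(basis_vec i) f y| <= M.
  apply: (@filter_forall _ _ (fun i y => is_true (`|'D_(basis_vec i) f y| <= M)) (nbhs x) _) => i.
  have := cdf i x; move/cvgrPdist_lt => /(_ 1 ltr01); apply: filterS => y.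
  move=> h; apply: le_trans (leM i).
  rewrite -[X in `|X|](subrK ('D_(basis_vec i) f x)) addrC.
  by rewrite (le_trans (ler_normD _ _))// lerD2l distrC ltW.
move/nbhs_ballP => [del /= del0 delM].
(* The corners of the staircase: the first [k] coordinates come from [y], the others from [x], so it
   runs from [x] at [k = 0] to [y] at [k = d]. *)
pose z (y : E) k : E := \row_i (if (i < k)%N then y ord0 i else x ord0 i).
have zS y (k : 'I_d) : z y k.+1 = (y ord0 k - x ord0 k) *: basis_vec k + z y k.
  apply/rowP => i; rewrite !mxE eqxx /= ltnS leq_eqVlt.
  case: (altP (i =P k)) => [->|ik]; first by rewrite eqxx ltnn mulr1 subrK.
  by rewrite -val_eqE in ik; rewrite (negbTE ik) mulr0 add0r.
have step y (k : 'I_d) : ball x del y ->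
    `|f (z y k.+1) - f (z y k)| <= M * `|y ord0 k - x ord0 k|.
  move=> [_ xy].
  (* The coordinate increment may have either sign, hence the minimum and maximum with 0; every
     point of the edge stays in the ball where [M] is a bound. *)
  have inb s : Num.min 0 (y ord0 k - x ord0 k) <= s <= Num.max 0 (y ord0 k - x ord0 k) ->
      `|'D_(basis_vec k) f (s *: basis_vec k + z y k)| <= M.
    move=> sI; apply: delM; split => // i j; rewrite (ord1 i) /ball /= !mxE eqxx /=.
    have := xy ord0 j; rewrite /ball /= => xyj.
    case: (altP (j =P k)) => [jk|jk].
      rewrite -jk ltnn mulr1 in sI *; apply: le_lt_trans xyj.
      move: sI; rewrite opprD addrCA subrr addr0 normrN distrC.
      case: (leP 0 (y ord0 j - x ord0 j)) => h /andP[h1 h2].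
        by rewrite !ger0_norm.
      by rewrite !ler0_norm ?lerN2// ltW.
    rewrite mulr0 add0r; case: ifP => _ //; by rewrite subrr normr0.
  rewrite zS.
  have [h|h] := leP 0 (y ord0 k - x ord0 k).
    have := @line_increment_le R E f (z y k) (basis_vec k) M 0 _ h (fun s => df k _).
    rewrite scale0r add0r subr0 (ger0_norm h); apply => s sI.
    by apply: inb; rewrite (min_idPl h) (max_idPr h).
  have := @line_increment_le R E f (z y k) (basis_vec k) M _ 0 (ltW h) (fun s => df k _).
  rewrite scale0r add0r sub0r (ltr0_norm h) distrC; apply => s sI.
  by apply: inb; rewrite (min_idPr (ltW h)) (max_idPl (ltW h)).
have inc y : ball x del y -> `|f y - f x| <= \sum_(k < d) M * `|y ord0 k - x ord0 k|.
  move=> xy.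
  have -> : f y = f (z y d) by congr f; apply/rowP => i; rewrite mxE ltn_ord.
  have -> : f x = f (z y 0%N) by congr f; apply/rowP => i; rewrite mxE.
  rewrite -(telescope_sumr (fun k => f (z y k)))// big_mkord.
  by rewrite (le_trans (ler_norm_sum _ _ _))//; apply: ler_sum => k _; exact: step.
apply/(@cvgrPdist_lt _ _ _ _ (nbhs_filter x)) => e e0.
(* Adding 1 keeps the divisor positive when [d = 0] and makes the final inequality strict. *)
have coef0 : 0 < M * d%:R + 1 by rewrite ltr_wpDl// mulr_ge0.
pose r := Num.min del (e / (M * d%:R + 1)).
have r0 : 0 < r by rewrite lt_min del0 divr_gt0.
apply/nbhs_ballP; exists r => //= y xy.
have xyd : ball x del y by apply: le_ball xy; rewrite ge_min lexx.
rewrite distrC; apply: le_lt_trans (inc _ xyd) _.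
apply: (@le_lt_trans _ _ (M * d%:R * r)).
  rewrite -mulrA -mulr_sumr ler_wpM2l//.
  rewrite mulr_natl -[X in _ *+ X]card_ord -sumr_const; apply: ler_sum => k _.
  by case: xy => _ /(_ ord0 k); rewrite /ball /= distrC => /ltW.
have : r <= e / (M * d%:R + 1) by rewrite ge_min lexx orbT.
rewrite ler_pdivlMr// => h; apply: lt_le_trans h.
by rewrite mulrC ltr_pM2l// ltrDl.
Qed.

Lemma continuous_rowP F : (forall i, continuous (fun x => F x ord0 i)) -> continuous F.
Proof.
move=> cF x; apply/(@cvgrPdist_lt _ _ _ _ (nbhs_filter x)) => e e0.
have : \forall y \near x, forall i, `|F x ord0 i - F y ord0 i| < e.
  apply: (@filter_forall _ _ (fun i y => is_true (`|F x ord0 i - F y ord0 i| < e)) (nbhs x) _) => i.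
  by have /cvgrPdist_lt := cF i x; exact.
apply: filterS => y h.
rewrite [X in X < _]/Num.Def.normr/= mx_normrE (bigmax_lt _ e0)//= => -[i j] _.
by rewrite !mxE (ord1 i).
Qed.

Lemma C1_continuous F : C1 F -> continuous F.
Proof.
move=> C1F; apply: continuous_rowP => j; apply: continuous_of_partials => i.
  by move=> x; have [/(_ x)/derivable_mxP/(_ ord0 j)] := C1F i.
have [dF cF] := C1F i.
rewrite (_ : 'D_ _ _ = fun x => ('D_(basis_vec i) F x) ord0 j); last first.
  by apply/funext => x; rewrite (derive_mx (dF x)) mxE.
move=> x; exact: (@continuous_comp _ _ _ ('D_(basis_vec i) F)
  (fun M : E => M ord0 j) x (cF x) (@coord_continuous _ _ _ _ _ _)).
Qed.

Lemma grad_logE f x : (forall i, derivable f x (basis_vec i)) -> 0 < f x ->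
  grad_log f x = (f x)^-1 *: grad f x.
Proof.
move=> df f0; apply/rowP => i; rewrite !mxE.
by have [_ ->] := is_derive_ln (df i) f0.
Qed.

Lemma div_scale f F x :
  (forall i, derivable f x (basis_vec i)) ->
  (forall i, derivable (fun y => F y ord0 i) x (basis_vec i)) ->
  div (fun y => f y *: F y) x = f x * div F x + dotv (grad f x) (F x).
Proof.
move=> df dF; rewrite /div /dotv mulr_sumr -big_split; apply: eq_bigr => i _ /=.
rewrite (_ : (fun y => _) = f * (fun y => F y ord0 i)); last first.
  by apply/funext => y; rewrite mxE.
rewrite deriveM// mxE; congr (_ + _); by rewrite -[_ *: _]/(_ * _) mulrC.
Qed.

End row_calculus.

(** * Composition with maps continuous on a subset *)

Section within_continuity.

Lemma within_continuous_comp_sub (X Y Z : topologicalType) (A : set X) (B : set Y)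
    (f : X -> Y) (g : Y -> Z) :
  continuous f -> (forall x, A x -> B (f x)) ->
  {within B, continuous g} -> {within A, continuous (g \o f)}.
Proof.
move=> cf AB /subspace_continuousP cg; apply/subspace_continuousP => x Ax.
move=> U /(cg _ (AB _ Ax)) /cf.
apply: (@filterS _ (nbhs x) (nbhs_filter x)) => y /= + Ay; apply; exact: AB.
Qed.

End within_continuity.

(** * Time integrals and their measurability in a parameter *)

Section time_integrals.
Context (R : realType) (T : R).
Hypothesis T0 : 0 < T.
Local Notation leb := (@lebesgue_measure R).

Lemma clamp_itv t : 0 <= clamp T t <= T.
Proof.
rewrite /clamp le_max lexx /= ge_max (ltW T0) /=.
by rewrite ge_min lexx.
Qed.

Lemma clamp_id t : 0 <= t <= T -> clamp T t = t.
Proof. by case/andP => t0 tT; rewrite /clamp (min_idPr tT) (max_idPr t0). Qed.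

Lemma continuous_clamp : continuous (clamp T).
Proof.
move=> t; apply: (@continuous_max _ _ (cst 0) (fun t => Num.min T t)).
  exact: cvg_cst.
by apply: (@continuous_min _ _ (cst T) id); [exact: cvg_cst|exact: cvg_id].
Qed.

Lemma continuous_time_integrable (g : R -> R) : {within `[0, T], continuous g} ->
  leb.-integrable `[0, T] (EFin \o g).
Proof.
by move=> cg; apply: continuous_compact_integrable => //; exact: segment_compact.
Qed.

Lemma measurable_floor_grid (c : R) (k : int) : 0 < c ->
  measurable [set t : R | Num.floor (t * c) = k].
Proof.
move=> c0.
rewrite (_ : mkset _ = `[k%:~R / c, (k + 1)%:~R / c[%classic)//.
apply/seteqP; split => t /=; rewrite in_itv /= ler_pdivrMr// ltr_pdivlMr//.
  by move=> <-; exact: floor_itv.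
by move=> h; apply/floor_def.
Qed.

(** Measurability in [o] at each time and continuity in [t] give joint measurability, by
    discretizing time; Tonelli then gives measurability of the integral. *)
Lemma measurable_time_integral dO (O : measurableType dO) (h : O -> R -> R) :
  (forall t, 0 <= t <= T -> measurable_fun setT (h ^~ t)) ->
  (forall o, {within `[0, T], continuous (h o)}) ->
  measurable_fun setT (fun o => time_integral (h o) T).
Proof.
move=> mh ch.
(* Clamping extends the integrand continuously to the whole line, so the grid points may fall
   outside [[0, T]]. *)
pose H (p : O * measurableTypeR R) : R := h p.1 (clamp T p.2).
pose grid n (t : R) : R := (Num.floor (t * n.+1%:R))%:~R / n.+1%:R.
have cH o : continuous (fun t => h o (clamp T t)).
  apply/continuous_subspace_setT.
  apply: (within_continuous_comp_sub continuous_clamp _ (ch o)).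
  by move=> t _; rewrite /= in_itv /=; exact: clamp_itv.
have mH : measurable_fun setT H.
  apply: (@measurable_fun_cvg _ _ _ _ (fun n p => h p.1 (clamp T (grid n p.2)))).
    move=> n _ B mB; rewrite setTI.
    pose c k : R := clamp T (k%:~R / n.+1%:R).
    (* The discretized function takes one section of [h] on each grid cell, so its preimages are
       countable unions of rectangles. *)
    rewrite (_ : _ @^-1` _ = \bigcup_(k : int)
        ((h ^~ (c k) @^-1` B) `*` [set t | Num.floor (t * n.+1%:R) = k])).
      apply: countable_bigcupT_measurable => [|k]; first exact: countableP.
      apply: measurableX; last exact: measurable_floor_grid.
      by rewrite -[X in measurable X]setTI; apply: mh => //; exact: clamp_itv.
    apply/seteqP; split => -[w t] /=; last by move=> [k _] [/= hB kE]; rewrite /grid kE.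
    by move=> hB; exists (Num.floor (t * n.+1%:R)).
  move=> [w t] _ /=; apply: (continuous_cvg _ (cH w t)).
  apply/cvgrPdist_lt => e e0.
  have := @cvg_harmonic R; move/cvgrPdist_lt => /(_ e e0).
  apply: filterS => n /=; rewrite sub0r normrN ger0_norm ?invr_ge0// => ne.
  have n0 : 0 < n.+1%:R :> R by [].
  have /andP[f1 f2] := floor_itv (t * n.+1%:R).
  apply: le_lt_trans ne; rewrite /grid ler_norml.
  have -> : t = t * n.+1%:R / n.+1%:R by rewrite mulfK// gt_eqF.
  rewrite -mulrBl mulfK ?gt_eqF//; apply/andP; split.
    apply: (@le_trans _ _ 0); first by rewrite oppr_le0 invr_ge0.
    by rewrite mulr_ge0 ?invr_ge0// subr_ge0.
  rewrite ler_pdivrMr// mulVf ?gt_eqF// lerBlDl.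
  by move: f2; rewrite intrD => /ltW.
pose G (p : O * measurableTypeR R) : \bar R := (H p * \1_(`[0, T]%classic) p.2)%:E.
have mG : measurable_fun setT G.
  apply/measurable_EFinP; apply: measurable_funM => //.
  by apply: measurableT_comp => //; exact: measurable_indic.
(* The real integral is [fine] of an extended one, so the positive and negative parts can be
   integrated separately by Tonelli. *)
have E o : time_integral (h o) T =
    fine (fubini_F leb (G ^\+)%E o - fubini_F leb (G ^\-)%E o).
  have GE : (EFin \o h o) \_ `[0, T] = fun t => G (o, t).
    apply/funext => t; rewrite patchE /G /H /= indicE.
    case: ifPn => [|_]; last by rewrite mulr0.
    by rewrite inE/= in_itv/= => tI; rewrite mulr1 clamp_id.
  have := integral_mkcond (mu := leb) `[0, T]%classic (EFin \o h o).
  rewrite GE [RHS]integralE => GI.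
  have GI' := congr1 fine GI; rewrite [LHS]GI' /fubini_F.
  congr (fine (_ - _)); apply: eq_integral => t _.
    by rewrite !funeposE.
  by rewrite !funenegE.
rewrite (_ : (fun _ => _) = fun o =>
    fine (fubini_F leb (G ^\+)%E o - fubini_F leb (G ^\-)%E o)); last first.
  by apply/funext => o; exact: E.
apply: measurableT_comp => //; apply: emeasurable_funB.
- by apply: measurable_fun_fubini_tonelli_F => //; exact: measurable_funepos.
- by apply: measurable_fun_fubini_tonelli_F => //; exact: measurable_funeneg.
Qed.

End time_integrals.

(** * Left-point sums on path space and the existence of Ito integrals *)

Section path_functionals.
Context (R : realType) (d : nat) (T : R).
Local Notation E := 'rV[R]_d.
Local Notation path := (Cpath T d).

Lemma continuous_measurable_row (f : E -> R) : continuous f -> measurable_fun setT f.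
Proof.
move=> cf; apply: (measurability _ (RGenOInfty.measurableE R)) => _ [_ [a ->] <-].
rewrite setTI; apply: open_measurable_mx.
rewrite (_ : _ @^-1` _ = f @^-1` [set x | a < x]).
  have oa : open [set x : R | a < x] by exact: open_gt.
  by apply: open_comp oa => x _; exact: cf.
by apply/seteqP; split => M /=; rewrite in_itv/= andbT.
Qed.

Lemma measurable_evaluation t : measurable_fun setT (fun w : path => w t).
Proof.
by move=> _ B mB; rewrite setTI; apply: sub_sigma_algebra; exists t, B.
Qed.

Lemma measurable_continuous_evaluation (f : E -> R) t : continuous f ->
  measurable_fun setT (fun w : path => f (w t)).
Proof.
move=> cf; apply: (measurableT_comp (continuous_measurable_row cf)).
exact: measurable_evaluation.
Qed.

Lemma measurable_ito_sum (F : R -> E -> E) s : 0 < T ->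
  (forall t, 0 <= t <= T -> continuous (F t)) -> itv_partition 0 T s ->
  measurable_fun setT (fun w : path => ito_sum F s w).
Proof.
move=> T0 cF ps; rewrite /ito_sum; under eq_fun do rewrite big_mkord.
apply: measurable_sum => k; apply: measurable_sum => i; apply: measurable_funM.
  apply: (measurable_continuous_evaluation (f := fun x => F _ x ord0 i)) => x.
  apply: (@continuous_comp _ _ _ (F _) (fun M : E => M ord0 i)).
    apply: cF; rewrite itv_partition_nth_ge ?itv_partition_nth_le// ltnS ltnW//.
  exact: coord_continuous.
under eq_fun do rewrite !mxE.
by apply: measurable_funB; apply: (measurable_continuous_evaluation
  (f := fun x : E => x ord0 i)) => x; exact: coord_continuous.
Qed.

Lemma ito_sum_scaleB (c : R) (F G H : R -> E -> E) s (w : path) :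
  (forall t x, 0 <= t <= T -> F t x = c *: (G t x - H t x)) ->
  itv_partition 0 T s ->
  ito_sum F s w = c * (ito_sum G s w - ito_sum H s w).
Proof.
move=> FE ps; rewrite /ito_sum -sumrB mulr_sumr big_nat_cond [RHS]big_nat_cond.
apply: eq_bigr => k /andP[/andP[_ ks] _]; rewrite FE; last first.
  by rewrite itv_partition_nth_ge ?itv_partition_nth_le// ltnS ltnW.
rewrite /dotv -sumrB mulr_sumr; apply: eq_bigr => i _; rewrite !mxE; ring.
Qed.

Lemma exists_fine_partition delta : 0 < T -> 0 < delta ->
  exists2 s, itv_partition 0 T s & mesh_lt (T := T) s delta.
Proof.
move=> T0 d0.
have [N] := ltr_add_invr (divr_gt0 d0 T0); rewrite add0r => Nd.
have N0 : 0 < N.+1%:R :> R by [].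
(* Equal steps of length [T / N.+1]; the list starts at [k.+1] because a partition list omits the
   left end point 0. *)
pose s := mkseq (fun k => T * k.+1%:R / N.+1%:R) N.+1.
have sz : size s = N.+1 by rewrite size_mkseq.
have nthE k : (k <= N.+1)%N -> nth T (0 :: s) k = T * k%:R / N.+1%:R.
  case: k => [|k] kN /=; first by rewrite mulr0 mul0r.
  by rewrite nth_mkseq.
exists s.
  split.
    apply/(pathP T) => k; rewrite sz => kN.
    rewrite (nthE _ (ltnW kN)) -[nth T s k]/(nth T (0 :: s) k.+1) nthE//.
    by rewrite ltr_pM2r ?invr_gt0// ltr_pM2l// ltr_nat.
  by rewrite (last_nth T) sz nthE// mulfK// gt_eqF.
move=> k; rewrite sz => kN; rewrite !nthE//; last exact: ltnW.
rewrite -mulrBl -mulrBr -natr1 (addrC _ 1) addrK mulr1.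
by rewrite mulrC -ltr_pdivlMr.
Qed.

(** A sequential version of the mesh tending to 0, suited to the results on sequences converging in
    probability. *)
Definition fine_partitions (p : nat -> seq R) :=
  (forall n, itv_partition 0 T (p n)) /\
  forall delta, 0 < delta -> \forall n \near \oo, mesh_lt (T := T) (p n) delta.

Lemma ito_integral_cvg (P : probability path R) F I p : 0 < T ->
  (forall t, 0 <= t <= T -> continuous (F t)) ->
  ito_integral P F I -> fine_partitions p ->
  cvg_in_prob P (fun n w => ito_sum F (p n) w) I.
Proof.
move=> T0 cF [mI hI] [pp mp] e e0.
apply/prob_cvg0P => [n|eta eta0].
  by apply: measurable_dist_ge => //; exact: measurable_ito_sum.
have [delta delta0 hd] := hI _ _ e0 eta0.
by apply: filterS (mp _ delta0) => n; exact: hd.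
Qed.

Lemma mesh_lt_le s (a c : R) : a <= c ->
  mesh_lt (T := T) s a -> mesh_lt (T := T) s c.
Proof. by rewrite /mesh_lt => /= ac ms k ks; exact: lt_le_trans (ms k ks) ac. Qed.

Lemma harmonic_fine_partitions (p : nat -> seq R) :
  (forall n, itv_partition 0 T (p n)) ->
  (forall n, mesh_lt (T := T) (p n) n.+1%:R^-1) -> fine_partitions p.
Proof.
move=> pp mp; split => // delta d0.
have := @cvg_harmonic R; move/cvgrPdist_lt => /(_ _ d0).
apply: filterS => n /=; rewrite sub0r normrN ger0_norm ?invr_ge0// => /ltW nd.
exact: mesh_lt_le nd (mp n).
Qed.

Section cauchy.
Variables (P : probability path R) (F : R -> E -> E).
Hypothesis T0 : 0 < T.
Hypothesis cF : forall t, 0 <= t <= T -> continuous (F t).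
Hypothesis cauchyF : forall p q, fine_partitions p -> fine_partitions q ->
  forall e, 0 < e ->
  P [set w | e <= `|ito_sum F (p n) w - ito_sum F (q n) w|] @[n --> \oo] --> 0%E.

(** Otherwise, for every [n], some two partitions of mesh below [n.+1%:R^-1] have sums that are far
    apart with probability at least [eta]. These form two fine sequences contradicting [cauchyF]. *)
Lemma ito_sum_uniform_cauchy e eta : 0 < e -> 0 < eta ->
  exists2 delta, 0 < delta & forall s s', itv_partition 0 T s -> itv_partition 0 T s' ->
    mesh_lt (T := T) s delta -> mesh_lt (T := T) s' delta ->
    (P [set w | (e <= `|ito_sum F s w - ito_sum F s' w|)%R] < eta%:E)%E.
Proof.
move=> e0 eta0; apply: contrapT => noD.
have /choice[pq pqP] n : exists pq : seq R * seq R,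
    [/\ itv_partition 0 T pq.1, itv_partition 0 T pq.2,
      mesh_lt (T := T) pq.1 n.+1%:R^-1, mesh_lt (T := T) pq.2 n.+1%:R^-1 &
      (eta%:E <= P [set w | (e <= `|ito_sum F pq.1 w - ito_sum F pq.2 w|)%R])%E].
  apply: contrapT => nopq; apply: noD; exists n.+1%:R^-1; first by rewrite invr_gt0.
  move=> s s' ps ps' ms ms'; rewrite ltNge; apply/negP => h; apply: nopq.
  by exists (s, s').
have f1 : fine_partitions (fun n => (pq n).1).
  by apply: harmonic_fine_partitions => n; case: (pqP n).
have f2 : fine_partitions (fun n => (pq n).2).
  by apply: harmonic_fine_partitions => n; case: (pqP n).
have /prob_cvg0P := cauchyF f1 f2 e0; case/(_ _ _ eta0) => [n|N _ /(_ _ (leqnn N))].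
  by case: (pqP n) => *; apply: measurable_dist_ge; exact: measurable_ito_sum.
by rewrite /= ltNge; case: (pqP N) => _ _ _ _ ->.
Qed.

(** The sums along one rapidly refined sequence have a limit [I] in probability; any partition of
    small mesh is then compared with a far member of that sequence. *)
Lemma cauchy_ito_integral : exists I, ito_integral P F I.
Proof.
pose u n : R := 2^-1 ^+ n.+1.
have u0 n : 0 < u n by rewrite exprn_gt0// invr_gt0.
have /choice[del delP] n : exists delta, 0 < delta /\
    forall s s', itv_partition 0 T s -> itv_partition 0 T s' ->
    mesh_lt (T := T) s delta -> mesh_lt (T := T) s' delta ->
    (P [set w | (u n <= `|ito_sum F s w - ito_sum F s' w|)%R] < (u n)%:E)%E.
  by have [delta ? ?] := ito_sum_uniform_cauchy (u0 n) (u0 n); exists delta.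
(* The bound [del n.-1] makes [p n.+1] as fine as [del n] requires, so that [p n] and [p n.+1] can
   be compared at tolerance [u n]. *)
have /choice[p pP] n : exists s, itv_partition 0 T s /\
    mesh_lt (T := T) s (Num.min n.+1%:R^-1 (Num.min (del n) (del n.-1))).
  have m0 : 0 < Num.min (n.+1%:R^-1 : R) (Num.min (del n) (del n.-1)).
    by rewrite !lt_min invr_gt0 ltr0n /= !(proj1 (delP _)).
  by have [s s1 s2] := exists_fine_partition T0 m0; exists s.
have pp n := proj1 (pP n).
have mp n : measurable_fun setT (fun w : path => ito_sum F (p n) w).
  exact: measurable_ito_sum.
have [||I mI cI] := @fast_cauchy_in_prob_cvg _ _ _ P (fun n w => ito_sum F (p n) w).
- exact: mp.
- move=> n; apply: ltW; apply: (proj2 (delP n)) => //.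
    by apply: mesh_lt_le (proj2 (pP n.+1)); rewrite !ge_min lexx !orbT.
  by apply: mesh_lt_le (proj2 (pP n)); rewrite !ge_min lexx !orbT.
exists I; split => // e eta e0 eta0.
have e20 : 0 < e / 2 by rewrite divr_gt0.
have eta20 : 0 < eta / 2 by rewrite divr_gt0.
have [delta delta0 hd] := ito_sum_uniform_cauchy e20 eta20.
exists delta => // s ps ms.
have ms' := measurable_ito_sum T0 cF ps.
have : \forall n \near \oo, mesh_lt (T := T) (p n) delta /\
    (P [set w | (e / 2 <= `|ito_sum F (p n) w - I w|)%R] < (eta / 2)%:E)%E.
  apply: filterI.
    have := @cvg_harmonic R; move/cvgrPdist_lt => /(_ _ delta0).
    apply: filterS => n /=; rewrite sub0r normrN ger0_norm ?invr_ge0// => /ltW nd.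
    apply: mesh_lt_le (proj2 (pP n)); apply: le_trans nd.
    by rewrite ge_min lexx.
  have /prob_cvg0P := cI _ e20; apply => // n; exact: measurable_dist_ge.
case=> N _ /(_ _ (leqnn N))[mN PN].
have PsN := hd _ _ ps (pp N) ms mN.
apply: le_lt_trans (_ : _ <= P [set w | (e / 2 <= `|ito_sum F s w - ito_sum F (p N) w|)%R] +
  P [set w | (e / 2 <= `|ito_sum F (p N) w - I w|)%R])%E _; last first.
  by rewrite [eta in X in (_ < X)%E]splitr EFinD; exact: lteD.
apply: le_trans (measureU2 _ _ _); [|exact: measurable_dist_ge..].
apply: le_measure; rewrite ?inE; first exact: measurable_dist_ge.
  by apply: measurableU; exact: measurable_dist_ge.
move=> w /(@dist_ge_split _ _ _ (ito_sum F (p N) w)).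
by rewrite [`|I w - _|]distrC.
Qed.

End cauchy.

End path_functionals.

(** * Continuity of the algebraic expressions occurring in the drifts *)

Section continuity_algebra.
Context (R : realType) (X : topologicalType).

Lemma continuous_pair (Y Z : topologicalType) (f : X -> Y) (g : X -> Z) :
  continuous f -> continuous g -> continuous (fun x => (f x, g x)).
Proof. by move=> cf cg x; apply: cvg_pair; [exact: cf|exact: cg]. Qed.

Lemma continuous_sum_sqr n (g : 'I_n -> X -> R) :
  (forall i, continuous (g i)) -> continuous (fun x => \sum_i g i x * g i x).
Proof.
move=> cg; apply: continuous_big => [|i _ x]; last by apply: cvgM; exact: cg.
exact: add_continuous.
Qed.

Lemma continuous_quotient (f g : X -> R) :
  continuous f -> continuous g -> (forall x, g x != 0) ->
  continuous (fun x => f x / g x).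
Proof.
by move=> cf cg g0 x; apply: cvgM; [exact: cf|apply: cvgV => //; exact: cg].
Qed.

Lemma continuous_affine (c : R) (f g : X -> R) : continuous f -> continuous g ->
  continuous (fun x => - f x + c * g x).
Proof.
move=> cf cg x; apply: cvgD; first by apply: cvgN; exact: cf.
by apply: cvgM; [exact: cvg_cst|exact: cg].
Qed.

End continuity_algebra.

(** Allows an integrand to be modified outside [[0, T]], where positivity of [rho] is not
    assumed. *)
Lemma within_itv_eq_continuous (R : realType) (T : R) (f g : R -> R) :
  (forall t, 0 <= t <= T -> f t = g t) ->
  {within `[0, T], continuous f} -> {within `[0, T], continuous g}.
Proof.
by move=> fg; apply: subspace_eq_continuous => t; rewrite inE /= in_itv /=; exact: fg.
Qed.

(** * The entropy production rate and the two Girsanov exponents *)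

Section entropy_rate.
Context (R : realType) (d : nat) (eps T : R).
Context (b : 'rV[R]_d -> 'rV[R]_d) (rho : R -> 'rV[R]_d -> R).
Hypotheses (eps_gt0 : 0 < eps) (T_gt0 : 0 < T) (b_C1 : C1 b).
Hypothesis rho_gt0 : forall t x, 0 <= t <= T -> 0 < rho t x.
Hypothesis rho_C12 : C12 T rho.
Hypothesis rho_FP : fokker_planck (T := T) eps b rho.
Local Notation E := 'rV[R]_d.
Local Notation slab := (`[0, T] `*` [set: E] : set (R * E)).
Local Notation leb := (@lebesgue_measure R).
Local Notation backward := (reverse_drift (T := T) eps b rho).

(** The field inside the Stratonovich integral of [total_entropy_production]: the velocity at time
    [T - t], multiplied by [2 / eps]. *)
Let F t x := (2 / eps) *: ((rho (T - t) x)^-1 *: current eps b rho (T - t) x).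

Lemma reflect_itv t : 0 <= t <= T -> 0 <= T - t <= T.
Proof. by move=> /andP[t0 tT]; rewrite subr_ge0 tT lerBlDr lerDl. Qed.

Lemma continuous_slice (g : R -> E -> R) t :
  {within slab, continuous (fun p => g p.1 p.2)} -> 0 <= t <= T -> continuous (g t).
Proof.
move=> cg tT; apply/continuous_subspace_setT.
apply: (within_continuous_comp_sub (f := fun y => (t, y)) _ _ cg) => [|x _].
  by apply: continuous_pair; [exact: cst_continuous|move=> x; exact: cvg_id].
by split => //=; rewrite in_itv.
Qed.

Lemma continuous_along_path (g : R -> E -> R) (w : Cpath T d) :
  {within slab, continuous (fun p => g p.1 p.2)} ->
  {within `[0, T], continuous (fun t => g (T - t) (w t))}.
Proof.
move=> cg.
apply: (within_continuous_comp_sub (f := fun t => (T - t, w t)) _ _ cg) => [|t].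
  apply: continuous_pair; last exact: path_continuous.
  by move=> t; apply: cvgB; [exact: cvg_cst|exact: cvg_id].
by rewrite /= in_itv /= => tT; split => //=; rewrite in_itv /=; exact: reflect_itv.
Qed.

Let rho_derivable t x i : 0 <= t <= T -> derivable (rho t) x (basis_vec i).
Proof. by case: rho_C12 => _ _ /(_ i)[h _] _; exact: h. Qed.

Lemma grad_log_rhoE t x i : 0 <= t <= T ->
  grad_log (rho t) x ord0 i = (rho t x)^-1 * 'D_(basis_vec i) (rho t) x.
Proof.
move=> tT; rewrite grad_logE; first by rewrite !mxE.
  by move=> j; exact: rho_derivable.
exact: rho_gt0.
Qed.

Lemma backwardE t x i : 0 <= t <= T -> backward t x ord0 i =
  - b x ord0 i + eps * ('D_(basis_vec i) (rho (T - t)) x / rho (T - t) x).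
Proof.
by move=> tT; rewrite [X in eps * X]mulrC !mxE -grad_log_rhoE ?reflect_itv// !mxE.
Qed.

Let b_coord i : continuous (fun x => b x ord0 i).
Proof.
move=> x; apply: (@continuous_comp _ _ _ b (fun M : E => M ord0 i)).
  exact: C1_continuous.
exact: coord_continuous.
Qed.

Lemma continuous_backward t : 0 <= t <= T -> continuous (backward t).
Proof.
move=> tT; apply: continuous_rowP => i.
rewrite (_ : (fun x => _) = fun x => - b x ord0 i +
    eps * ('D_(basis_vec i) (rho (T - t)) x / rho (T - t) x)); last first.
  by apply/funext => x; rewrite backwardE.
have [c0 _ /(_ i)[_ c1] _] := rho_C12.
have tT' := reflect_itv tT.
apply: continuous_affine; first exact: b_coord.
apply: continuous_quotient.
- exact: (continuous_slice (g := fun t => 'D_(basis_vec i) (rho t)) c1 tT').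
- exact: (continuous_slice c0 tT').
- by move=> x; rewrite gt_eqF// rho_gt0.
Qed.

Let path_coord (w : Cpath T d) i : continuous (fun t => b (w t) ord0 i).
Proof.
move=> t; apply: (@continuous_comp _ _ _ w (fun x => b x ord0 i)).
  exact: path_continuous.
exact: b_coord.
Qed.

(* Clamping makes the denominator nonzero on the whole line. *)
Let rho_path_neq0 (w : Cpath T d) t : rho (T - clamp T t) (w t) != 0.
Proof. by rewrite gt_eqF// rho_gt0// reflect_itv// clamp_itv. Qed.

Let continuous_rho_path (w : Cpath T d) :
  {within `[0, T], continuous (fun t => rho (T - clamp T t) (w t))}.
Proof.
apply: (@within_itv_eq_continuous _ _ (fun t => rho (T - t) (w t))).
  by move=> t tT; rewrite clamp_id.
by have [c0 _ _ _] := rho_C12; exact: (continuous_along_path c0).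
Qed.

Lemma continuous_drift_sqr (w : Cpath T d) :
  {within `[0, T], continuous (fun t => dotv (b (w t)) (b (w t)))}.
Proof.
by apply: continuous_subspaceT; apply: continuous_sum_sqr => i; exact: path_coord.
Qed.

Lemma continuous_backward_sqr (w : Cpath T d) :
  {within `[0, T], continuous (fun t => dotv (backward t (w t)) (backward t (w t)))}.
Proof.
pose g i t : R := - b (w t) ord0 i +
  eps * ('D_(basis_vec i) (rho (T - t)) (w t) / rho (T - clamp T t) (w t)).
apply: (@within_itv_eq_continuous _ _ (fun t => \sum_i g i t * g i t)).
  by move=> t tT; apply: eq_bigr => i _; rewrite /g clamp_id// backwardE.
have [_ _ c1 _] := rho_C12.
(* Continuity within [[0, T]] is continuity for the subspace topology, so the algebraic lemmas apply
   with that space as domain. *)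
apply: (@continuous_sum_sqr _ (subspace `[0, T])) => i.
apply: continuous_affine; first by apply: continuous_subspaceT; exact: path_coord.
have [_ {}c1] := c1 i.
apply: continuous_quotient => //.
  exact: (continuous_along_path (g := fun t => 'D_(basis_vec i) (rho t)) c1).
exact: continuous_rho_path.
Qed.

Lemma continuous_log_rate (w : Cpath T d) : {within `[0, T],
  continuous (fun t => dtime T rho (T - t) (w t) / rho (T - t) (w t))}.
Proof.
apply: (@within_itv_eq_continuous _ _
    (fun t => dtime T rho (T - t) (w t) / rho (T - clamp T t) (w t))).
  by move=> t tT; rewrite clamp_id.
have [_ [_ c1] _ _] := rho_C12.
apply: (@continuous_quotient _ (subspace `[0, T])) => //.
- exact: (continuous_along_path (g := dtime T rho) c1).
- exact: continuous_rho_path.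
Qed.

Lemma entropy_fieldE t x : 0 <= t <= T ->
  F t x = (2 / eps) *: (b x - (eps / 2) *: grad_log (rho (T - t)) x).
Proof.
move=> tT; congr (_ *: _); have tT' := reflect_itv tT.
apply/rowP => i; have r0 := rho_gt0 x tT'.
have := grad_log_rhoE x i tT'; rewrite !mxE => ->.
by field; rewrite gt_eqF.
Qed.

(** The difference [b - backward] is twice the velocity at time [T - t]. Left-point sums of [F] are
    thus scaled differences of those of the two drifts. *)
Lemma entropy_field_drifts t x : 0 <= t <= T ->
  F t x = eps^-1 *: (b x - backward t x).
Proof.
move=> tT; rewrite entropy_fieldE//; apply/rowP => i; rewrite !mxE.
by field; rewrite gt_eqF.
Qed.

(* With v = b - (eps / 2) grad log rho, the Fokker-Planck equation reads
   dt rho / rho + div v = - v . grad log rho; this is the difference of the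
   quadratic terms of the two Girsanov exponents since v = (b - backward) / 2 and
   eps grad log rho = b + backward. *)
Lemma entropy_rate t x : 0 <= t <= T ->
  dtime T rho (T - t) x / rho (T - t) x + eps / 2 * div (F t) x =
  (2 * eps)^-1 * (dotv (backward t x) (backward t x) - dotv (b x) (b x)).
Proof.
move=> tT; have tT' := reflect_itv tT.
set r := rho (T - t); pose v y := b y - (eps / 2) *: grad_log r y.
have r0 : 0 < r x by exact: rho_gt0.
(* Writing the gradient of the logarithm as a quotient reduces this to the second spatial
   derivatives supplied by [rho_C12]. *)
have v_derivable i : derivable (fun y => v y ord0 i) x (basis_vec i).
  rewrite (_ : (fun y => _) = (fun y => b y ord0 i) -
      (fun y => (eps / 2) *: ((r y)^-1 * 'D_(basis_vec i) r y))); last first.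
    by apply/funext => y; rewrite /v !fctE -grad_log_rhoE// !mxE.
  apply: derivableB.
    by have [/(_ x)/derivable_mxP/(_ ord0 i) h _] := b_C1 i.
  apply: derivableZ; apply: derivableM.
    by apply: derivableV; [rewrite gt_eqF|exact: rho_derivable].
  by have [_ _ _ /(_ i i)[h _]] := rho_C12; exact: h.
have divF : div (F t) x = (2 / eps) * div v x.
  rewrite (_ : F t = fun y => cst (2 / eps) y *: v y); last first.
    by apply/funext => y; rewrite entropy_fieldE.
  rewrite div_scale//.
  have -> : dotv (grad (cst (2 / eps)) x) (v x) = 0.
    by rewrite /dotv big1// => i _; rewrite mxE derive_cst mul0r.
  by rewrite addr0.
rewrite rho_FP// -/r div_scale//; last by move=> i; exact: rho_derivable.
have -> : dotv (grad r x) (v x) = r x * dotv (grad_log r x) (v x).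
  rewrite /dotv mulr_sumr; apply: eq_bigr => i _.
  rewrite grad_log_rhoE// mxE mulrA; congr (_ * _).
  by rewrite mulVKf// gt_eqF.
rewrite -mulrDr mulNr mulrAC divff ?gt_eqF// mul1r divF.
rewrite mulrA (_ : eps / 2 * (2 / eps) = 1) ?mul1r; last first.
  by field; rewrite gt_eqF.
rewrite opprD addrAC addNr add0r /dotv -sumrB mulr_sumr -sumrN.
apply: eq_bigr => i _; rewrite /v /reverse_drift -/r.
move: (grad_log r x) => L; rewrite !mxE.
by field; rewrite gt_eqF.
Qed.

Lemma entropy_rate_integral (w : Cpath T d) :
  time_integral (fun t => dtime T rho (T - t) (w t) / rho (T - t) (w t)) T +
  eps / 2 * time_integral (fun t => div (F t) (w t)) T =
  (2 * eps)^-1 * (time_integral (fun t => dotv (backward t (w t)) (backward t (w t))) T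
    - time_integral (fun t => dotv (b (w t)) (b (w t))) T).
Proof.
pose q t := dtime T rho (T - t) (w t) / rho (T - t) (w t).
pose B t := dotv (backward t (w t)) (backward t (w t)).
pose D t := dotv (b (w t)) (b (w t)).
have iq : leb.-integrable `[0, T] (EFin \o q).
  by apply: continuous_time_integrable; exact: continuous_log_rate.
have iB : leb.-integrable `[0, T] (EFin \o B).
  by apply: continuous_time_integrable; exact: continuous_backward_sqr.
have iD : leb.-integrable `[0, T] (EFin \o D).
  by apply: continuous_time_integrable; exact: continuous_drift_sqr.
have integrable_subr (f g : R -> R) : leb.-integrable `[0, T] (EFin \o f) ->
    leb.-integrable `[0, T] (EFin \o g) ->
    leb.-integrable `[0, T] (EFin \o (fun t => f t - g t)).
  move=> fi gi; rewrite (_ : _ \o _ = fun t => ((f t)%:E - (g t)%:E)%E).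
    exact: integrableB.
  by apply/funext.
have iBD := integrable_subr _ _ iB iD.
have iZ : leb.-integrable `[0, T] (EFin \o (fun t => (2 * eps)^-1 * (B t - D t))).
  rewrite (_ : _ \o _ = fun t => ((2 * eps)^-1%R%:E * (B t - D t)%R%:E)%E).
    exact: integrableZl.
  by apply/funext.
(* Solving [entropy_rate] for the divergence expresses it through [q], [B] and [D], whose
   integrability is already established; linearity does the rest. *)
have -> : time_integral (fun t => div (F t) (w t)) T =
    time_integral (fun t => (2 / eps) * ((2 * eps)^-1 * (B t - D t) - q t)) T.
  apply: eq_Rintegral => t; rewrite inE /= in_itv /= => tT.
  by rewrite -entropy_rate// /q; field; rewrite !gt_eqF// rho_gt0// reflect_itv.
rewrite /time_integral RintegralZl//; last exact: integrable_subr.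
rewrite RintegralB// RintegralZl// RintegralB//.
by rewrite -/q; field; rewrite gt_eqF.
Qed.

Lemma measurable_drift_sqr :
  measurable_fun setT (fun w : Cpath T d => time_integral (fun t => dotv (b (w t)) (b (w t))) T).
Proof.
apply: measurable_time_integral => // [t tT|w]; last exact: continuous_drift_sqr.
apply: (measurable_continuous_evaluation (f := fun x => dotv (b x) (b x))).
by apply: continuous_sum_sqr => i; exact: b_coord.
Qed.

Lemma measurable_backward_sqr : measurable_fun setT
  (fun w : Cpath T d => time_integral (fun t => dotv (backward t (w t)) (backward t (w t))) T).
Proof.
apply: measurable_time_integral => // [t tT|w]; last exact: continuous_backward_sqr.
apply: (measurable_continuous_evaluation (f := fun x => dotv (backward t x) (backward t x))).
apply: continuous_sum_sqr => i x.
apply: (@continuous_comp _ _ _ (backward t) (fun M : E => M ord0 i)).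
  exact: continuous_backward.
exact: coord_continuous.
Qed.

End entropy_rate.

(** * Disintegration of the path law along the starting point *)

Section disintegration.
Context (R : realType) (d : nat) (T : R).
Local Notation E := 'rV[R]_d.
Local Notation path := (Cpath T d).
Context (nu : probability path R) (k : R.-pker E ~> path).
Hypothesis nuE : conditional_law nu k.

Lemma conditional_lawT (A : set path) : measurable A ->
  nu A = (\int[nu]_w k (w 0%R) A)%E.
Proof.
move=> mA; have := nuE mA (@measurableT _ E); cbv zeta.
have -> : [set w : path | [set: E] (w 0)] = setT by apply/seteqP.
by rewrite setIT.
Qed.

Lemma measurable_start_kernel (A : set path) : measurable A ->
  measurable_fun setT (fun w : path => k (w 0) A).
Proof.
move=> mA; apply: (measurableT_comp (measurable_kernel k A mA)).
exact: measurable_evaluation.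
Qed.

(** The mixture is indexed by the path itself, acting through [w 0], so the law of the starting
    point need not be introduced as a separate measure. *)
Lemma ge0_integral_conditional (f : path -> \bar R) :
  measurable_fun setT f -> (forall w, (0 <= f w)%E) ->
  (\int[nu]_w f w = \int[nu]_w \int[k (w 0%R)]_w' f w')%E.
Proof.
move=> mf f0; apply: (@ge0_integral_mixture _ _ _ _ _ nu (fun w : path => k (w 0))) => //.
- exact: measurable_start_kernel.
- exact: conditional_lawT.
Qed.

Lemma conditional_null (M : set path) : measurable M -> nu M = 0%E ->
  {ae nu, forall w : path, k (w 0) M = 0%E}.
Proof.
move=> mM; rewrite conditional_lawT// => M0.
have := ae_eq_integral_abs nu measurableT (measurable_start_kernel mM).
under eq_integral do rewrite gee0_abs//.
by move=> /iffLR/(_ M0); apply: filterS => w /(_ Logic.I).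
Qed.

(** Dominated convergence over the starting point; conditional probabilities are bounded by 1. *)
Lemma conditional_cvg0 (A : (set path)^nat) : (forall n, measurable (A n)) ->
  {ae nu, forall w : path, k (w 0) (A n) @[n --> \oo] --> 0%E} ->
  nu (A n) @[n --> \oo] --> 0%E.
Proof.
move=> mA kA.
have [||||| _ _] := @dominated_convergence _ _ _ nu setT measurableT
    (fun n w => k (w 0) (A n)) (cst 0%E) (cst 1%E).
- by move=> n; exact: measurable_start_kernel.
- exact: measurable_cst.
- by apply: filterS kA => w kw _.
- exact: finite_measure_integrable_cst.
- apply: aeW => w n _; rewrite gee0_abs// -(@prob_kernel _ _ _ _ _ k (w 0)).
  by apply: le_measure; rewrite ?inE.
rewrite integral_cst// mul0e; apply: cvg_trans; apply: near_eq_cvg.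
by apply: nearW => n /=; rewrite conditional_lawT.
Qed.

(** The starting point has a density, so Lebesgue-null sets of starting points are [nu]-null. This
    carries hypotheses stated for almost every [x] over to paths. *)
Lemma ae_start (f : E -> R) (Q : E -> Prop) : measurable_fun setT f -> density_at 0 nu f ->
  {ae lebesgue_rV R d, forall x, Q x} -> {ae nu, forall w : path, Q (w 0)}.
Proof.
move=> mf nuf [M [mM M0 QM]]; exists [set w : path | M (w 0)]; split.
- by rewrite -[X in measurable X]setTI; exact: measurable_evaluation.
- rewrite nuf//; apply: null_set_integral => //.
  by apply/measurable_EFinP; exact: measurable_funTS.
- by move=> w /= nQ; exact: QM.
Qed.

End disintegration.

(** * Ito integrals of a scaled difference of two fields, under [nu] and under [mux] *)

Lemma continuous_scaled_difference (R : realType) (X : topologicalType)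
    (V : normedModType R) (c : R) (f g : X -> V) : continuous f -> continuous g ->
  continuous (fun x => c *: (f x - g x)).
Proof.
by move=> cf cg x; apply: cvgZl_tmp; apply: cvgB; [exact: cf|exact: cg].
Qed.

Section ito_integral_of_difference.
Context (R : realType) (d : nat) (T : R).
Local Notation E := 'rV[R]_d.
Local Notation path := (Cpath T d).
Context (nu : probability path R) (k : R.-pker E ~> path)
  (mux : E -> probability path R).
Context (c : R) (F G H : R -> E -> E).
Hypotheses (T0 : 0 < T) (c0 : 0 < c).
Hypothesis nuE : conditional_law nu k.
Hypothesis FE : forall t x, 0 <= t <= T -> F t x = c *: (G t x - H t x).
Hypothesis cG : forall t, 0 <= t <= T -> continuous (G t).
Hypothesis cH : forall t, 0 <= t <= T -> continuous (H t).

Lemma continuous_scaleB t : 0 <= t <= T -> continuous (F t).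
Proof.
move=> tT; rewrite (_ : F t = fun x => c *: (G t x - H t x)).
  apply: continuous_scaled_difference; [exact: cG|exact: cH].
by apply/funext => x; exact: FE.
Qed.

Lemma ito_sum_difference_cvg (mu : probability path R) IG IH p :
  ito_integral mu G IG -> ito_integral mu H IH -> fine_partitions T p ->
  cvg_in_prob mu (fun n w => ito_sum F (p n) w) (fun w => c * (IG w - IH w)).
Proof.
move=> iG iH fp; have [pp _] := fp.
rewrite (_ : (fun n w => _) =
    fun n w => c * (ito_sum G (p n) w - ito_sum H (p n) w)); last first.
  by apply/funext => n; apply/funext => w; exact: ito_sum_scaleB.
apply: cvg_in_prob_scaleB => //.
- by move=> n; exact: measurable_ito_sum.
- by move=> n; exact: measurable_ito_sum.
- by case: iG.
- by case: iH.
- exact: ito_integral_cvg iG fp.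
- exact: ito_integral_cvg iH fp.
Qed.

(** Under [mux (w 0)] the sums along any two fine sequences share the limit [c * (IG - IH)], so
    their difference vanishes in probability. [density_cvg0] and [conditional_cvg0] carry this over
    to [nu]. *)
Lemma exists_ito_integral :
  {ae nu, forall w : path, exists (D IG IH : path -> R), [/\ measurable_fun setT D,
     forall w', 0 <= D w',
     forall A, measurable A -> k (w 0) A = (\int[mux (w 0%R)]_(w' in A) (D w')%:E)%E,
     ito_integral (mux (w 0)) G IG & ito_integral (mux (w 0)) H IH]} ->
  exists I, ito_integral nu F I.
Proof.
move=> good; apply: cauchy_ito_integral => //; first exact: continuous_scaleB.
move=> p q fp fq e e0; have [[pp _] [pq _]] := (fp, fq).
have mF s : itv_partition 0 T s -> measurable_fun setT (fun w : path => ito_sum F s w).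
  by apply: measurable_ito_sum => //; exact: continuous_scaleB.
apply: (conditional_cvg0 nuE).
  by move=> n; apply: measurable_dist_ge; exact: mF.
apply: filterS good => w [D [IG [IH [mD D0 kD iG iH]]]].
have mI : measurable_fun setT (fun w' => c * (IG w' - IH w')).
  apply: measurable_funM => //; apply: measurable_funB; [by case: iG|by case: iH].
apply: (density_cvg0 mD D0 kD).
- by rewrite -ge0_fin_numE// fin_num_measure.
- by rewrite (@prob_kernel _ _ _ _ _ k (w 0)) ltry.
- by move=> n; apply: measurable_dist_ge; exact: mF.
apply: (cvg_in_prob_cauchy _ _ mI) => //.
- by move=> n; exact: mF.
- by move=> n; exact: mF.
- exact: ito_sum_difference_cvg.
- exact: ito_sum_difference_cvg.
Qed.

(** Convergence in probability under [nu] need not pass to the conditional laws, but almost sure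
    convergence does. Along a fast sequence of partitions the sums converge to [I] almost surely
    under [nu], hence under [mux (w 0)], where the limit is also [c * (IG - IH)]. *)
Lemma ito_integral_conditional I : ito_integral nu F I ->
  {ae nu, forall w : path, mux (w 0) `<< k (w 0) ->
    forall IG IH, ito_integral (mux (w 0)) G IG -> ito_integral (mux (w 0)) H IH ->
    {ae mux (w 0), forall w', I w' = c * (IG w' - IH w')}}.
Proof.
move=> iF; have [mI hI] := iF.
pose u n : R := 2^-1 ^+ n.+1.
have u0 n : 0 < u n by rewrite exprn_gt0// invr_gt0.
have mF s : itv_partition 0 T s -> measurable_fun setT (fun w : path => ito_sum F s w).
  by apply: measurable_ito_sum => //; exact: continuous_scaleB.
(* Each partition is fine enough both for the mesh to tend to 0 and for the error probabilities to
   be summable. *)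
have /choice[p pP] n : exists s, [/\ itv_partition 0 T s,
    mesh_lt (T := T) s n.+1%:R^-1 &
    (nu [set w | (u n <= `|ito_sum F s w - I w|)%R] < (u n)%:E)%E].
  have [delta delta0 hd] := hI _ _ (u0 n) (u0 n).
  have m0 : 0 < Num.min delta n.+1%:R^-1 by rewrite lt_min delta0 invr_gt0 ltr0n.
  have [s ps ms] := exists_fine_partition T0 m0; exists s; split => //.
    by apply: mesh_lt_le ms; rewrite ge_min lexx orbT.
  by apply: hd => //; apply: mesh_lt_le ms; rewrite ge_min lexx.
have fp : fine_partitions T p by apply: harmonic_fine_partitions => n; case: (pP n).
have mFp n : measurable_fun setT (fun w : path => ito_sum F (p n) w).
  by apply: mF; case: (pP n).
have : {ae nu, forall w, ito_sum F (p n) w @[n --> \oo] --> I w}.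
  have := @fast_in_prob_ae _ _ _ nu (fun n w => ito_sum F (p n) w) (fun=> I) mFp (fun=> mI).
  have h n : (nu [set w | (u n <= `|ito_sum F (p n) w - I w|)%R] <= (u n)%:E)%E.
    by apply: ltW; case: (pP n).
  move=> /(_ h); apply: filterS => w fast; apply/cvgrPdist_lt => e e0.
  have half0 : 0 <= 2^-1 :> R by rewrite invr_ge0.
  have : (2^-1 : R) ^+ n @[n --> \oo] --> 0.
    by apply: cvg_expr; rewrite ger0_norm// invf_lt1// ltr1n.
  move=> /cvgrPdist_lt/(_ e e0); apply: filterS2 fast => n h1.
  rewrite sub0r normrN ger0_norm ?exprn_ge0// distrC; apply: lt_trans.
  apply: lt_le_trans h1 _; rewrite exprS ler_piMl ?exprn_ge0//.
  by rewrite invf_le1// ler1n.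
(* The exceptional set [M] is null for [nu], hence for almost every [k (w 0)], hence for [mux (w 0)]
   by domination. *)
move=> [M [mM M0 nM]]; have := conditional_null nuE mM M0.
apply: filterS => w kM dom IG IH iG iH.
have muM : mux (w 0) M = 0%E.
  by have /null_content_dominatesP := dom; apply.
have cI : cvg_in_prob (mux (w 0)) (fun n w => ito_sum F (p n) w) I.
  by apply: ae_cvg_in_prob => //; exists M; split.
apply: (cvg_in_prob_unique mFp mI _ cI (ito_sum_difference_cvg iG iH fp)).
apply: measurable_funM => //; apply: measurable_funB; [by case: iG|by case: iH].
Qed.

End ito_integral_of_difference.

(** * The integral fluctuation relation for the total entropy production *)

Theorem theorem6p4 (R : realType) (d : nat) (eps T : R)
    (b : 'rV[R]_d -> 'rV[R]_d) (rho : R -> 'rV[R]_d -> R)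
    (nu : probability (Cpath T d) R)
    (nux revx : R.-pker 'rV[R]_d ~> Cpath T d)
    (mux : 'rV[R]_d -> probability (Cpath T d) R)
    (eps_gt0 : 0 < eps) (T_gt0 : 0 < T)
    (b_C1 : C1 b)
    (nu_law : weak_solution_law eps (fun=> b) nu)
    (rho_density : forall t, 0 <= t <= T -> density_at t nu (rho t))
    (rho_gt0 : forall t x, 0 <= t <= T -> 0 < rho t x)
    (rho_C12 : C12 T rho)
    (rho_FP : fokker_planck (T := T) eps b rho)
    (nuxE : conditional_law nu nux)
    (revxE : conditional_law (pushforward nu reverse) revx)
    (muxE : forall x, scaled_brownian_law eps x (mux x))
    (rev_law : weak_solution_law eps (reverse_drift (T := T) eps b rho)
       (pushforward nu reverse))
    (equiv_ae : {ae lebesgue_rV R d, forall x,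
       [/\ mutually_equivalent (nux x) (mux x),
           mutually_equivalent (revx x) (mux x) &
           mutually_equivalent (nux x) (revx x)]})
    (girsanov_ae : {ae lebesgue_rV R d, forall x,
       girsanov_density eps (fun=> b) (nux x) (mux x) /\
       girsanov_density eps (reverse_drift (T := T) eps b rho) (revx x) (mux x)}) :
  (exists S, total_entropy_production eps b rho nu S) /\
  (forall S, total_entropy_production eps b rho nu S ->
     ('E_nu[fun w => expR (- S w)] = 1)%E).
Proof.
pose F t x := (2 / eps) *: ((rho (T - t) x)^-1 *: current eps b rho (T - t) x).
pose back := reverse_drift (T := T) eps b rho.
pose B2 (w : Cpath T d) := time_integral (fun t => dotv (b (w t)) (b (w t))) T.
pose K2 (w : Cpath T d) := time_integral (fun t => dotv (back t (w t)) (back t (w t))) T.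
(* The log-density rate and the Stratonovich correction are traded for the difference of the
   quadratic Girsanov terms, leaving one Ito integral. *)
have tep S : total_entropy_production eps b rho nu S <->
    exists2 I, ito_integral nu F I &
      forall w, S w = I w + (2 * eps)^-1 * (K2 w - B2 w).
  split=> [[J [I iI JE] SE]|[I iI SE]].
    exists I => // w; rewrite SE JE addrCA; congr (_ + _).
    exact: entropy_rate_integral.
  exists (fun w => I w + eps / 2 * time_integral (fun t => div (F t) (w t)) T).
    by exists I.
  move=> w; rewrite SE addrCA; congr (_ + _); apply/esym.
  exact: entropy_rate_integral.
have mB2 : measurable_fun setT B2 by exact: measurable_drift_sqr.
have mK2 : measurable_fun setT K2 by exact: measurable_backward_sqr.
have FE t x : 0 <= t <= T -> F t x = eps^-1 *: (b x - back t x).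
  exact: entropy_field_drifts.
have cb t : 0 <= t <= T -> continuous b by move=> _; exact: C1_continuous.
have cback t : 0 <= t <= T -> continuous (back t) by exact: continuous_backward.
have T00 : 0 <= (0 : R) <= T by rewrite lexx ltW.
have ieps : 0 < eps^-1 by rewrite invr_gt0.
have mrho0 : measurable_fun setT (rho 0).
  apply: continuous_measurable_row; have [c0 _ _ _] := rho_C12.
  exact: (continuous_slice c0 T00).
have start (Q : 'rV[R]_d -> Prop) : {ae lebesgue_rV R d, forall x, Q x} ->
    {ae nu, forall w : Cpath T d, Q (w 0)}.
  by apply: (ae_start mrho0); exact: rho_density.
pose dens (I A : Cpath T d -> R) w := expR (eps^-1 * I w - (2 * eps)^-1 * A w).
have mdens I A : measurable_fun setT I -> measurable_fun setT A ->
    measurable_fun setT (dens I A).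
  move=> mI mA; apply: measurableT_comp => //; apply: measurable_funB;
    exact: measurable_funM.
have [I0 iI0] : exists I, ito_integral nu F I.
  apply: (exists_ito_integral (k := nux) (mux := mux) T_gt0 ieps nuxE FE cb cback).
  have := start _ girsanov_ae; apply: filterS => w [[I1 i1 k1] [I2 i2 _]].
  exists (dens I1 B2), I1, I2; split => //; first by apply: mdens => //; case: i1.
  by move=> w'; exact: expR_ge0.
split; first by exists (fun w => I0 w + (2 * eps)^-1 * (K2 w - B2 w)); apply/tep; exists I0.
move=> S /tep[I iI SE]; have [mI _] := iI.
have mS : measurable_fun setT S.
  rewrite (_ : S = fun w => I w + (2 * eps)^-1 * (K2 w - B2 w)); last exact/funext.
  apply: measurable_funD => //; apply: measurable_funM => //; exact: measurable_funB.
pose f (w : Cpath T d) : \bar R := (expR (- S w))%:E.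
have mf : measurable_fun setT f.
  apply/measurable_EFinP; apply: measurableT_comp => //.
  exact: measurableT_comp.
have f0 w : (0 <= f w)%E by rewrite lee_fin expR_ge0.
(* The identity already holds conditionally on almost every starting point, whatever the initial
   distribution. *)
have inner : {ae nu, forall w : Cpath T d, (\int[nux (w 0%R)]_w' f w' = 1)%E}.
  have := ito_integral_conditional mux T_gt0 ieps nuxE FE cb cback iI.
  apply: filterS2 (filterI (start _ equiv_ae) (start _ girsanov_ae)) => w.
  move=> [[[_ dom] _ _] [[I1 i1 k1] [I2 i2 k2]]] /(_ dom I1 I2 i1 i2) IE.
  have [[mI1 _] [mI2 _]] := (i1, i2).
  have D0 w' : 0 <= dens I1 B2 w' by exact: expR_ge0.
  rewrite (ge0_integral_density (mdens _ _ mI1 mB2) D0 k1)//.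
  (* Under [mux (w 0)], the density of [nux] times [expR (- S)] should be the density of [revx],
     whose integral is the total mass 1. *)
  transitivity (revx (w 0) setT); last exact: (@prob_kernel _ _ _ _ _ revx (w 0)).
  rewrite k2//; apply: ge0_ae_eq_integral => //.
  - apply: emeasurable_funM => //; apply/measurable_EFinP; exact: mdens.
  - apply/measurable_EFinP; exact: (mdens I2 K2).
  - by move=> w' _; rewrite mule_ge0// lee_fin.
  (* With [I = eps^-1 * (I1 - I2)], the terms in [I1] and [B2] cancel in the exponent, leaving the
     one built from [I2] and [K2]. *)
  apply: filterS IE => w' IE _; rewrite /f -EFinM -expRD SE IE.
  congr (expR _)%:E; rewrite -/(K2 w'); ring.
rewrite unlock (ge0_integral_conditional nuxE mf f0).
transitivity (\int[nu]_w (cst 1%E w : \bar R))%E.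
  apply: ge0_ae_eq_integral => //.
  - apply: measurable_fun_integral_kernel => // A mA.
    exact: measurable_start_kernel.
  - by move=> w _; exact: integral_ge0.
  - by apply: filterS inner => w ->.
by rewrite integral_cst// mul1e; exact: probability_setT.
Qed.
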